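(* Let $(w_1,w_2)$ be a smooth solution, up to time $T>0$, of $$\partial_t w_1=\partial_x w_1-N(w_1,w_2)w_2,\qquad \partial_t w_2=-\partial_x w_2+N(w_1,w_2)w_1$$ on $I=[x_a,x_b]$ with periodic boundary conditions. Let $q\ge0$ and let $(w_1^h,w_2^h)\in V_q^h\times V_q^h$ be the numerical solution of the semi-discrete DG scheme described in the context with the upwind fluxes $$\widehat{w_1^h}=w_1^{h,+},\qquad \widetilde{w_2^h}=w_2^{h,-}.$$ Assume that $z_1(u,v):=N(u,v)u$ and $z_2(u,v):=N(u,v)v$ satisfy $\|\nabla z_1\|_{L^\infty}+\|\nabla z_2\|_{L^\infty}\le C_1$ for a positive constant $C_1$, and that the initial data are $w_1^h(x,0)=P_h^+w_1(x,0)$, $w_2^h(x,0)=P_h^-w_2(x,0)$. Then there exists a positive constant $\mathcal C$, depending only on the degree $q$, the bound $C_1$ and the shape regularity of the mesh, but independent of $h$, such that $$\|w_1(\cdot,T)-w_1^h(\cdot,T)\|_{L^2(I)}+\|w_2(\cdot,T)-w_2^h(\cdot,T)\|_{L^2(I)}\le\mathcal C h^{q+1}.$$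
   Context: **Nonlinearity.** $N(w_1,w_2)=N\big(\sqrt{w_1^2+w_2^2}\big)$ is real-valued, where the function $N(r)$, $r\ge0$, satisfies $N(0)=1$, $N(1)=0$, $N'(r)<0$, and $N(r)\to N_\infty<0$ as $r\to+\infty$. The gradients of $z_1,z_2$ are with respect to $(u,v)$, and the $L^\infty$ norms are taken over all arguments $(u,v)\in\mathbb{R}^2$. **Mesh and spaces.** $I=[x_a,x_b]$ is partitioned by $x_a=x_{1/2}<x_{3/2}<\dots<x_{M+1/2}=x_b$ into $M$ elements $I_j=(x_{j-1/2},x_{j+1/2})$; $h_j=x_{j+1/2}-x_{j-1/2}$, $h=\max_j h_j$, and $h/\min_j h_j<\zeta$ with $\zeta>0$ fixed during mesh refinement (shape regularity). $V_q^h$ is the space of functions whose restriction to each $I_j$ is a polynomial of degree at most $q$ (element of $\mathcal P^q(I_j)$), with no continuity across elements; $w_1^h(\cdot,t),w_2^h(\cdot,t)\in V_q^h$ for each $t$. One-sided limits are $v^{\pm}(x)=\lim_{\epsilon\to0^\pm}v(x+\epsilon)$, and $|_{j+\frac12}$ means evaluation at $x_{j+1/2}$. Periodicity identifies the endpoints $x_{1/2}$ and $x_{M+1/2}$, so the left limit at $x_{1/2}$ is the left limit at $x_{M+1/2}$, and the right limit at $x_{M+1/2}$ is the right limit at $x_{1/2}$; the upwind fluxes are used at all nodes. **Quadrature.** On each $I_j$ a quadrature rule with nodes $x_{k,j}\in I_j$ and weights $\underline\omega_{k,j}>0$ is fixed, such that for all $j$ and all $\phi\in\mathcal P^q(I_j)$,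 $\sum_k\underline\omega_{k,j}\phi^2(x_{k,j})=\int_{I_j}\phi^2\,dx$, and $$\sum_j\Big|\sum_k\underline\omega_{k,j}\phi(x_{k,j})f(x_{k,j})-\int_{I_j}\phi f\,dx\Big|\le C_0h^{q+1}\|\phi\|_{L^2(I)}|f|_{H^{q+1}(I)}$$ for all $\phi\in V_q^h$, $f\in H^{q+1}(I)$, with $C_0$ independent of $h$ and $f$. **DG scheme.** For all $\phi,\psi\in V_q^h$, all $j=1,\dots,M$ and all $t$, $$\int_{I_j}(w_{1t}^h\phi+w_1^h\phi_x)\,dx+\sum_k\underline\omega_{k,j}N\big(w_1^h(x_{k,j}),w_2^h(x_{k,j})\big)w_2^h(x_{k,j})\phi(x_{k,j})=\widehat{w_1^h}\phi^-\big|_{j+\frac12}-\widehat{w_1^h}\phi^+\big|_{j-\frac12},$$ $$\int_{I_j}(w_{2t}^h\psi-w_2^h\psi_x)\,dx-\sum_k\underline\omega_{k,j}N\big(w_1^h(x_{k,j}),w_2^h(x_{k,j})\big)w_1^h(x_{k,j})\psi(x_{k,j})=\widetilde{w_2^h}\psi^+\big|_{j-\frac12}-\widetilde{w_2^h}\psi^-\big|_{j+\frac12}.$$ **Gauss–Radau projections.** For $u\in H^{q+1}(I)$, $P_h^\pm u\in V_q^h$ are defined on each $I_j$ by $\int_{I_j}(P_h^\pm u-u)v\,dx=0$ for all $v\in\mathcal P^{q-1}(I_j)$ (this condition is void for $q=0$), together with $(P_h^+u)(x_{j-1/2}^+)=u(x_{j-1/2})$ for $P_h^+$ and $(P_h^-u)(x_{j+1/2}^-)=u(x_{j+1/2})$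 for $P_h^-$.
   Formalization: The constant C may also depend on the given solution (w1,w2), on I, T and the quadrature constant C0, not only on q, C1 and the shape regularity: on a fixed mesh the error is unbounded over large smooth solutions. C stays uniform in N, h, the mesh and the quadrature rule. *)

(* Defs.v *)
From HB Require Import structures.
From mathcomp Require Import all_boot all_order all_algebra.
From mathcomp Require Import all_classical all_reals all_analysis.

Set Implicit Arguments.
Unset Strict Implicit.
Unset Printing Implicit Defensive.

Import Order.TTheory GRing.Theory Num.Theory.
Import numFieldNormedType.Exports.

Local Open Scope classical_set_scope.
Local Open Scope ring_scope.

(* Functions of (x, t) are curried with the space variable first: [w x t].    *)

Section Nonlinearity.
Context {R : realType}.
Implicit Types (N : R -> R) (z : R -> R -> R).

(* Only the values N(r), r >= 0, matter; N'(0) is the right derivative.       *)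
Definition admissible_nonlinearity N : Prop :=
  [/\ N 0 = 1, N 1 = 0,
      forall r : R, 0 < r -> derivable N r 1 /\ derive1 N r < 0,
      exists2 d : R, d < 0 & r^-1 * (N r - N 0) @[r --> 0^'+] --> d &
      exists2 Ninf : R, Ninf < 0 & N r @[r --> +oo] --> Ninf].

Definition radial N (u v : R) : R := N (Num.sqrt (u ^+ 2 + v ^+ 2)).

Definition z1 N (u v : R) : R := radial N u v * u.

Definition z2 N (u v : R) : R := radial N u v * v.

Definition gradient_norm z (p : R * R) : R :=
  Num.sqrt (derive1 (z ^~ p.2) p.1 ^+ 2 + derive1 (z p.1) p.2 ^+ 2).

Definition Linfty_gradient z : \bar R :=
  ('N[lebesgue_measure \x lebesgue_measure]_+oo[EFin \o gradient_norm z])%E.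

End Nonlinearity.

Section ExactSolution.
Context {R : realType}.
Implicit Types (a b T : R) (w : R -> R -> R).

(* w is C^oo on [a, b] x [0, T] up to the boundary: D i j is the derivative   *)
(* of order i in x and j in t, extended continuously to the closed rectangle. *)
Definition smooth_on a b T w : Prop :=
  exists D : nat -> nat -> R -> R -> R,
    [/\ D 0%N 0%N = w,
        forall i j, {within `[a, b] `*` `[0, T],
                       continuous (fun p : R * R => D i j p.1 p.2)} &
        forall i j (x t : R), x \in `]a, b[ -> t \in `]0, T[ ->
          is_derive x 1 (D i j ^~ t) (D i.+1 j x t) /\
          is_derive t 1 (D i j x) (D i j.+1 x t)].

Definition periodic_bc a b T w : Prop :=
  forall t : R, t \in `[0, T] -> w a t = w b t.

Definition solves_pde a b T (N : R -> R) (w1 w2 : R -> R -> R) : Prop :=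
  forall x t : R, x \in `]a, b[ -> t \in `]0, T[ ->
    derive1 (w1 x) t = derive1 (w1 ^~ t) x - radial N (w1 x t) (w2 x t) * w2 x t /\
    derive1 (w2 x) t = - derive1 (w2 ^~ t) x + radial N (w1 x t) (w2 x t) * w1 x t.

End ExactSolution.

Section FunctionSpaces.
Context {R : realType}.
Implicit Types (a b : R) (f g phi : R -> R).

Definition L2norm a b f : \bar R :=
  ('N[lebesgue_measure]_2%:E[EFin \o (f \_ `[a, b])])%E.

Definition in_L2 a b f : Prop := (f \_ `[a, b]) \in Lfun lebesgue_measure 2%:E.

Definition test_function a b phi : Prop :=
  (forall n x, derivable (derive1n n phi) x 1) /\
  (exists c d : R, [/\ a < c, d < b & forall x, x \notin `[c, d] -> phi x = 0]).

Definition weak_derivative a b k f g : Prop :=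
  in_L2 a b g /\
  forall phi, test_function a b phi ->
    \int[lebesgue_measure]_(x in `[a, b]) (f x * derive1n k phi x) =
    (-1) ^+ k * \int[lebesgue_measure]_(x in `[a, b]) (g x * phi x).

(* H^m(a, b) for m >= 1; since point values are used, an element is given by  *)
(* its continuous representative. The seminorm |f|_{H^m} is [L2norm a b g]    *)
(* for any g such that [weak_derivative a b m f g].                           *)
Definition in_sobolev a b m f : Prop :=
  [/\ {within `[a, b], continuous f}, in_L2 a b f &
      forall k, (k <= m)%N -> exists g, weak_derivative a b k f g].

End FunctionSpaces.

(* A mesh of [a, b] is a sequence s with [itv_partition a b s]: a :: s lists  *)
(* the nodes x_{1/2} < ... < x_{M+1/2}, where M = size s. Elements are        *)
(* numbered from 0: [cell a s j], j < size s, is the element usually written  *)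
(* I_{j+1}, and [node a s j] is x_{j+1/2}.                                    *)
Section Mesh.
Context {R : realType}.
Implicit Types (a : R) (s : seq R) (v f p : R -> R).

Definition node a s (j : nat) : R := nth a (a :: s) j.

Definition cell a s (j : nat) : set R := `]node a s j, node a s j.+1[.

Definition cell_size a s (j : nat) : R := node a s j.+1 - node a s j.

Definition mesh_size a s : R := \big[Num.max/0]_(j < size s) cell_size a s j.

Definition min_cell_size a s : R :=
  \big[Num.min/mesh_size a s]_(j < size s) cell_size a s j.

(* The space V_q^h; values at the nodes are irrelevant.                       *)
Definition broken_poly q a s v : Prop :=
  forall j, (j < size s)%N ->
    exists2 P : {poly R}, (size P <= q.+1)%N & {in cell a s j, v =1 horner P}.

Definition right_lim v (x : R) : R := lim (v @ x^'+).

Definition left_lim v (x : R) : R := lim (v @ x^'-).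

(* One-sided traces at the nodes, the end nodes being identified.             *)
Definition trace_plus a s v (j : nat) : R :=
  right_lim v (node a s (if j == size s then 0%N else j)).

Definition trace_minus a s v (j : nat) : R :=
  left_lim v (node a s (if j == 0%N then size s else j)).

(* p = P_h^+ f, resp. p = P_h^- f; {poly R} elements of size at most q have   *)
(* degree at most q - 1, and only 0 qualifies when q = 0.                     *)
Definition radau_orthogonal q a s f p : Prop :=
  forall j (V : {poly R}), (j < size s)%N -> (size V <= q)%N ->
    \int[lebesgue_measure]_(x in cell a s j) ((p x - f x) * V.[x]) = 0.

Definition radau_plus q a s f p : Prop :=
  [/\ broken_poly q a s p, radau_orthogonal q a s f p &
      forall j, (j < size s)%N ->
        right_lim p (node a s j) = f (node a s j)].

Definition radau_minus q a s f p : Prop :=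
  [/\ broken_poly q a s p, radau_orthogonal q a s f p &
      forall j, (j < size s)%N ->
        left_lim p (node a s j.+1) = f (node a s j.+1)].

(* Element j carries the K j quadrature points xq j k, k < K j, with weights  *)
(* om j k.                                                                    *)
Definition admissible_quadrature q C0 a b s
    (K : nat -> nat) (xq om : nat -> nat -> R) : Prop :=
  [/\ forall j k, (j < size s)%N -> (k < K j)%N ->
        cell a s j (xq j k) /\ 0 < om j k,
      forall j (P : {poly R}), (j < size s)%N -> (size P <= q.+1)%N ->
        \sum_(k < K j) om j k * P.[xq j k] ^+ 2 =
        \int[lebesgue_measure]_(x in cell a s j) (P.[x] ^+ 2) &
      forall phi f g, broken_poly q a s phi ->
        in_sobolev a b q.+1 f -> weak_derivative a b q.+1 f g ->
        ((\sum_(j < size s)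
            `| \sum_(k < K j) om j k * (phi (xq j k) * f (xq j k))
               - \int[lebesgue_measure]_(x in cell a s j) (phi x * f x) |)%:E
         <= (C0 * mesh_size a s ^+ q.+1)%:E
            * L2norm a b phi * L2norm a b g)%E].

Definition dg_solution q T a s (K : nat -> nat) (xq om : nat -> nat -> R)
    (N : R -> R) (w1h w2h : R -> R -> R) : Prop :=
  [/\ forall t : R, t \in `[0, T] ->
        broken_poly q a s (w1h ^~ t) /\ broken_poly q a s (w2h ^~ t),
      forall j x, (j < size s)%N -> x \in cell a s j ->
        {within `[0, T], continuous (w1h x)} /\
        {within `[0, T], continuous (w2h x)},
      forall j (x t : R), (j < size s)%N -> x \in cell a s j -> t \in `]0, T[ ->
        derivable (w1h x) t 1 /\ derivable (w2h x) t 1,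
      forall (t : R) phi j, t \in `]0, T[ -> broken_poly q a s phi ->
        (j < size s)%N ->
        \int[lebesgue_measure]_(x in cell a s j)
            (derive1 (w1h x) t * phi x + w1h x t * derive1 phi x)
        + \sum_(k < K j) om j k
            * radial N (w1h (xq j k) t) (w2h (xq j k) t)
            * w2h (xq j k) t * phi (xq j k)
        = trace_plus a s (w1h ^~ t) j.+1 * left_lim phi (node a s j.+1)
          - trace_plus a s (w1h ^~ t) j * right_lim phi (node a s j) &
      forall (t : R) psi j, t \in `]0, T[ -> broken_poly q a s psi ->
        (j < size s)%N ->
        \int[lebesgue_measure]_(x in cell a s j)
            (derive1 (w2h x) t * psi x - w2h x t * derive1 psi x)
        - \sum_(k < K j) om j k
            * radial N (w1h (xq j k) t) (w2h (xq j k) t)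
            * w1h (xq j k) t * psi (xq j k)
        = trace_minus a s (w2h ^~ t) j * right_lim psi (node a s j)
          - trace_minus a s (w2h ^~ t) j.+1 * left_lim psi (node a s j.+1)].

End Mesh.

(* Main.v *)
Require Import Defs.
From HB Require Import structures.
From mathcomp Require Import all_boot all_order all_algebra.
From mathcomp Require Import all_classical all_reals all_analysis.
From mathcomp Require Import measurable_realfun ess_sup_inf ring lra.

Set Implicit Arguments.
Unset Strict Implicit.
Unset Printing Implicit Defensive.

Import Order.TTheory GRing.Theory Num.Theory.
Import numFieldNormedType.Exports.

Local Open Scope classical_set_scope.
Local Open Scope ring_scope.

(** The scheme is compared with the Gauss-Radau projections of the solution: [w1] is
    interpolated at the left end of each cell and [w2] at the right end, the ends from
    which their upwind fluxes are taken. The projection error is orthogonal to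
    polynomials of lower degree and has no flux, so it disappears from the transport
    terms, and only its time derivative and its values at the quadrature points
    remain. Testing the error equation with the discrete error xi (projection minus
    numerical solution) and adding the cells, the upwind fluxes leave a nonpositive
    quadratic form by periodicity ([cell_energy], [field_energy]). Hence

      d/dt of the sum of the squared norms  <=  A (the same sum) + B h ^ (2 q + 2),

    and the discrete error vanishes initially, so [gronwall] bounds it by a multiple of
    h ^ (q + 1). The projection error itself has that order, and the theorem follows.

    Four points carry the estimate.

    - The projection is linear in the function through q + 1 functionals, a value and
      moments ([radau_fun]), and its dual basis lives on the reference interval. This
      gives at once existence, a stability constant depending on the degree only, the
      error bound [radau_proj_error] by Taylor expansion, and the fact that projection
      and time derivative commute ([is_derive_radau_proj]).

    - Along the solution the nonlinear term equals the smooth function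
      w_x - w_t for [w1] and w_x + w_t for [w2]. Therefore the consistency of the quadrature
      is applied to a function with all derivatives bounded independently of N, and
      no smoothness of N enters.

    - The gradients of [z1] and [z2] are bounded almost everywhere only, with N' possibly
      discontinuous. On almost every line the exceptional set is null, and a function
      differentiable at every point, with a derivative bounded outside a null set, is
      Lipschitz ([derive_ae_lipschitz]); continuity extends this to all lines
      ([nonlinearity_lipschitz]).

    - Exactness of the quadrature on squares makes the squared norm of xi a finite
      weighted sum of its squares at the quadrature points, differentiable in time
      term by term. The time derivative of the numerical solution is again a
      polynomial on each cell, by interpolation ([derive_poly_family]).

    Both fields are treated at once: a boolean [e] is [false] for [w1] and [true] for
    [w2], and the sign of the transport term is [(-1) ^+ e]. *)

(** * Integrals of continuous functions over a cell *)

Section CellIntegral.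
Context {R : realType}.
Implicit Types (l r c : R) (f g : R -> R).
Notation mu := (@lebesgue_measure R).

Definition cell_int l r f : R := \int[mu]_(x in `]l, r[) f x.

Lemma continuous_mul f g :
  continuous f -> continuous g -> continuous (fun x => f x * g x).
Proof. by move=> cf cg x; apply: cvgM; [exact: cf|exact: cg]. Qed.

Lemma continuous_add f g :
  continuous f -> continuous g -> continuous (fun x => f x + g x).
Proof. by move=> cf cg x; apply: cvgD; [exact: cf|exact: cg]. Qed.

Lemma continuous_sub f g :
  continuous f -> continuous g -> continuous (fun x => f x - g x).
Proof. by move=> cf cg x; apply: cvgB; [exact: cf|exact: cg]. Qed.

Lemma continuous_scale c f : continuous f -> continuous (fun x => c * f x).
Proof. by move=> cf; apply: continuous_mul => // x; exact: cvg_cst. Qed.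

Lemma continuous_sum (I : Type) (s : seq I) (F : I -> R -> R) :
  (forall i, continuous (F i)) -> continuous (fun x => \sum_(i <- s) F i x).
Proof.
move=> cF; elim: s => [|i s IHs].
  by under eq_fun do rewrite big_nil; move=> x; exact: cvg_cst.
by under eq_fun do rewrite big_cons; exact: continuous_add.
Qed.

Lemma integrable_segment l r f :
  continuous f -> mu.-integrable `[l, r] (EFin \o f).
Proof.
move=> cf; apply: continuous_compact_integrable; first exact: segment_compact.
exact: continuous_subspaceT.
Qed.

Lemma integrable_cell l r f : continuous f -> mu.-integrable `]l, r[ (EFin \o f).
Proof.
move=> cf; apply: integrableS (integrable_segment l r cf) => //.
exact: subset_itv_oo_cc.
Qed.

Lemma cell_int_segment l r f :
  continuous f -> \int[mu]_(x in `[l, r]) f x = cell_int l r f.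
Proof.
move=> cf; rewrite /cell_int Rintegral_itv_bndo_bndc.
  rewrite Rintegral_itv_obnd_cbnd //.
  apply: integrableS (integrable_segment l r cf) => //.
  by apply: subset_itvr; rewrite bnd_simp.
exact: integrable_cell.
Qed.

Lemma eq_cell_int l r f g :
  (forall x, l < x < r -> f x = g x) -> cell_int l r f = cell_int l r g.
Proof.
move=> fg; apply: eq_Rintegral => x; rewrite inE /= in_itv /= => xlr.
exact: fg.
Qed.

Lemma cell_intD l r f g : continuous f -> continuous g ->
  cell_int l r (fun x => f x + g x) = cell_int l r f + cell_int l r g.
Proof. by move=> cf cg; apply: RintegralD => //; exact: integrable_cell. Qed.

Lemma cell_intB l r f g : continuous f -> continuous g ->
  cell_int l r (fun x => f x - g x) = cell_int l r f - cell_int l r g.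
Proof. by move=> cf cg; apply: RintegralB => //; exact: integrable_cell. Qed.

Lemma cell_intZ l r c f : continuous f ->
  cell_int l r (fun x => c * f x) = c * cell_int l r f.
Proof. by move=> cf; apply: RintegralZl => //; exact: integrable_cell. Qed.

Lemma cell_int0 l r : cell_int l r (fun=> 0) = 0.
Proof. by rewrite /cell_int Rintegral_cst // mul0r. Qed.

Lemma cell_int_sum (I : Type) (s : seq I) l r (F : I -> R -> R) :
  (forall i, continuous (F i)) ->
  cell_int l r (fun x => \sum_(i <- s) F i x) = \sum_(i <- s) cell_int l r (F i).
Proof.
move=> cF; elim: s => [|i s IHs].
  by under [in LHS]eq_fun do rewrite big_nil; rewrite big_nil cell_int0.
under [in LHS]eq_fun do rewrite big_cons.
rewrite big_cons cell_intD ?IHs //; exact: continuous_sum.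
Qed.

Lemma le_cell_int l r f g : continuous f -> continuous g ->
  (forall x, l < x < r -> f x <= g x) -> cell_int l r f <= cell_int l r g.
Proof.
by move=> cf cg fg; apply: le_Rintegral => //; exact: integrable_cell.
Qed.

Lemma cell_int_ge0 l r f :
  (forall x, l < x < r -> 0 <= f x) -> 0 <= cell_int l r f.
Proof.
by move=> f0; apply: Rintegral_ge0 => x; rewrite /= in_itv /=; exact: f0.
Qed.

Lemma cell_int_cst l r c : l <= r -> cell_int l r (fun=> c) = c * (r - l).
Proof.
move=> lr; rewrite /cell_int Rintegral_cst //= lebesgue_measure_itv /= lte_fin.
case: ltP => // rl; have -> : r = l by apply/eqP; rewrite eq_le lr rl.
by rewrite subrr.
Qed.

Lemma cell_int_norm_le l r c f : l <= r -> continuous f ->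
  (forall x, l < x < r -> `|f x| <= c) -> `|cell_int l r f| <= c * (r - l).
Proof.
move=> lr cf fc; rewrite -cell_int_cst //.
rewrite ler_norml -mulN1r -cell_intZ; last by move=> x; exact: cvg_cst.
by apply/andP; split; apply: le_cell_int => //; try (by move=> x; exact: cvg_cst);
  move=> x /fc; rewrite ler_norml ?mulN1r => /andP[].
Qed.

Lemma cell_int_FTC l r F f : l < r -> continuous F -> continuous f ->
  (forall x, l < x < r -> is_derive x 1 F (f x)) -> cell_int l r f = F r - F l.
Proof.
move=> lr cF cf dF; rewrite -cell_int_segment // /Rintegral.
rewrite (@continuous_FTC2 _ f F) //.
- exact: continuous_subspaceT.
- split.
  + by move=> x; rewrite in_itv /= => /dF [].
  + exact/cvg_at_right_filter/cF.
  + exact/cvg_at_left_filter/cF.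
- by move=> x; rewrite in_itv /= => /dF dFx; rewrite derive1E; exact: derive_val.
Qed.

Lemma mean_value_oo l r F f : l < r -> continuous F ->
  (forall x, l < x < r -> is_derive x 1 F (f x)) ->
  exists2 c, l < c < r & F r - F l = f c * (r - l).
Proof.
move=> lr cF dF; have dF' x : x \in `]l, r[ -> is_derive x 1 F (f x).
  by rewrite in_itv /=; exact: dF.
have [c] := MVT lr dF' (continuous_subspaceT cF).
by rewrite in_itv /=; exists c.
Qed.

Lemma mean_value l r F f : l <= r -> continuous F ->
  (forall x, l < x < r -> is_derive x 1 F (f x)) ->
  exists2 c, l <= c <= r & F r - F l = f c * (r - l).
Proof.
rewrite le_eqVlt => /predU1P[<- _ _|lr cF dF].
  by exists l; rewrite ?lexx // !subrr mulr0.
have [c /andP[lc cr] ->] := mean_value_oo lr cF dF.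
by exists c; rewrite ?ltW.
Qed.

Lemma is_derive_ge0_le l r F f : l <= r -> continuous F ->
  (forall x, l < x < r -> is_derive x 1 F (f x)) ->
  (forall x, l < x < r -> 0 <= f x) -> F l <= F r.
Proof.
rewrite le_eqVlt => /predU1P[-> //|lr] cF dF f0.
have [c clr Frl] := mean_value_oo lr cF dF.
by rewrite -subr_ge0 Frl mulr_ge0 ?f0 // subr_ge0 ltW.
Qed.

End CellIntegral.

(** * Polynomials on an interval *)

Section PolynomialsOnAnInterval.
Context {R : realType}.
Implicit Types (l r : R) (p : {poly R}).

(** The end points are avoided because the values of broken polynomials at the nodes
    of the mesh carry no information. *)
Definition sample l r (n i : nat) : R := l + i.+1%:R / n.+1%:R * (r - l).

Lemma sample_in l r n i : l < r -> (i < n)%N -> l < sample l r n i < r.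
Proof.
move=> lr lt_in; rewrite /sample; apply/andP; split.
  by rewrite ltrDl mulr_gt0 ?divr_gt0 ?ltr0n ?subr_gt0.
rewrite -ltrBrDl gtr_pMl ?subr_gt0 // ltr_pdivrMr ?ltr0n // mul1r ltr_nat.
by rewrite ltnS.
Qed.

Lemma sample_inj l r n : l < r -> injective (sample l r n).
Proof.
move=> lr i j /addrI /mulIf; rewrite subr_eq0 (gt_eqF lr) => /(_ isT).
by move/(divIf (lt0r_neq0 (ltr0Sn _ _))) => /eqP; rewrite eqr_nat eqSS => /eqP.
Qed.

Lemma poly_eq0_on l r p :
  l < r -> (forall x, l < x < r -> p.[x] = 0) -> p = 0.
Proof.
move=> lr p0; apply/eqP/negPn/negP => pN0.
set rs := [seq sample l r (size p) i | i <- iota 0 (size p)].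
have rs_uniq : uniq rs by rewrite map_inj_uniq ?iota_uniq //; exact: sample_inj.
have rs_root : all (root p) rs.
  apply/allP => _ /mapP[i + ->]; rewrite mem_iota /= add0n => lt_i.
  exact/rootP/p0/sample_in.
by have := max_poly_roots pN0 rs_root rs_uniq; rewrite size_map size_iota ltnn.
Qed.

Definition primitive p : {poly R} :=
  \poly_(i < (size p).+1) (p`_i.-1 / i%:R).

Lemma deriv_primitive p : (primitive p)^`() = p.
Proof.
apply/polyP => i; rewrite coef_deriv coef_poly ltnS /=.
case: ltnP => [_|le_pi]; last by rewrite mul0rn nth_default.
by rewrite -(mulr_natr (_ / _)) divfK // pnatr_eq0.
Qed.

Lemma is_derive_horner p (x : R) : is_derive x 1 (horner p) p^`().[x].
Proof.
apply: DeriveDef; first exact: derivable_horner.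
by rewrite -derive1E derivE.
Qed.

Lemma cell_int_poly l r p : l < r ->
  cell_int l r (horner p) = (primitive p).[r] - (primitive p).[l].
Proof.
move=> lr; apply: cell_int_FTC => //; try exact: continuous_horner.
by move=> x _; rewrite -{2}(deriv_primitive p); exact: is_derive_horner.
Qed.

(** A primitive is nondecreasing with equal values at both ends, hence constant. *)
Lemma poly_int_eq0 l r p : l < r -> (forall x, l < x < r -> 0 <= p.[x]) ->
  cell_int l r (horner p) = 0 -> p = 0.
Proof.
move=> lr p0 /eqP; rewrite cell_int_poly // subr_eq0 => /eqP Prl.
set P := primitive p in Prl.
have mono x y : l <= x -> x <= y -> y <= r -> P.[x] <= P.[y].
  move=> lx xy yr.
  apply: (@is_derive_ge0_le _ _ _ _ (horner P^`()) xy (@continuous_horner _ P)).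
  move=> z /andP[xz zy]; rewrite deriv_primitive p0 //.
  by rewrite (le_lt_trans lx) // (lt_le_trans zy).
have : P - P.[l]%:P = 0.
  apply: (poly_eq0_on lr) => x /andP[/ltW lx /ltW xr].
  rewrite !hornerE; apply/eqP; rewrite subr_eq0 eq_le.
  by rewrite -{1}Prl !mono.
move/(congr1 (@deriv _)); rewrite derivB derivC deriv0 subr0.
by rewrite deriv_primitive.
Qed.

End PolynomialsOnAnInterval.

(** * The functionals of the Gauss-Radau projection *)

Section RadauFunctionals.
Context {R : realType}.
Implicit Types (l r : R) (e : bool) (f g : R -> R) (p : {poly R}).

(** The left-going field takes its flux from the right of a node, that is, from the left
    end of a cell, so its projection ([e = false]) interpolates there; the right-going
    field is the mirror image. *)
Definition radau_end e l r : R := if e then r else l.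

(** The degrees of freedom of the Gauss-Radau projection; the moments are scaled
    so that they are invariant under affine maps of the interval. *)
Definition radau_fun l r e (i : nat) f : R :=
  if i is k.+1 then (r - l)^-1 * cell_int l r (fun x => f x * ((x - l) / (r - l)) ^+ k)
  else f (radau_end e l r).

Lemma continuous_affX l r k : continuous (fun x : R => ((x - l) / (r - l)) ^+ k).
Proof.
have -> : (fun x => ((x - l) / (r - l)) ^+ k)
          = horner (((r - l)^-1 *: ('X - l%:P)) ^+ k).
  by apply/funext => x; rewrite !hornerE; congr (_ ^+ _); exact: mulrC.
exact: continuous_horner.
Qed.

Lemma radau_fun_sum (I : Type) (s : seq I) l r e i (c : I -> R) (F : I -> R -> R) :
  (forall j, continuous (F j)) ->
  radau_fun l r e i (fun x => \sum_(j <- s) c j * F j x) =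
  \sum_(j <- s) c j * radau_fun l r e i (F j).
Proof.
case: i => [//|k] cF /=.
transitivity ((r - l)^-1 * cell_int l r
    (fun x => \sum_(j <- s) c j * (F j x * ((x - l) / (r - l)) ^+ k))).
  congr (_ * cell_int _ _ _); apply/funext => x; rewrite mulr_suml.
  by apply: eq_bigr => j _; rewrite mulrA.
have cFX j : continuous (fun x => F j x * ((x - l) / (r - l)) ^+ k).
  exact/continuous_mul/continuous_affX.
rewrite cell_int_sum => [|j]; last exact: continuous_scale.
rewrite mulr_sumr; apply: eq_bigr => j _.
by rewrite cell_intZ // mulrCA.
Qed.

Lemma radau_funB l r e i f g : continuous f -> continuous g ->
  radau_fun l r e i (fun x => f x - g x) =
  radau_fun l r e i f - radau_fun l r e i g.
Proof.
case: i => [//|k] cf cg /=; rewrite -mulrBr -cell_intB; last 2 first.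
- exact/continuous_mul/continuous_affX.
- exact/continuous_mul/continuous_affX.
by congr (_ * cell_int _ _ _); apply/funext => x; rewrite mulrBl.
Qed.

(** The powers of the affine coordinate span the polynomials of lower degree. *)
Lemma radau_fun_orth q l r e f (V : {poly R}) : l < r -> continuous f ->
  (forall k, (k <= q)%N -> radau_fun l r e k f = 0) ->
  (size V <= q)%N -> cell_int l r (fun x => f x * V.[x]) = 0.
Proof.
move=> lr cf f0 sV.
have hN0 : r - l != 0 by rewrite subr_eq0 gt_eqF.
pose W := V \Po ((r - l) *: 'X + l%:P).
have VE x : V.[x] = \sum_(k < size W) W`_k * ((x - l) / (r - l)) ^+ k.
  rewrite -horner_coef horner_comp hornerD hornerZ hornerX hornerC mulrC.
  by rewrite divfK // subrK.
have sW : (size W <= q)%N.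
  apply: leq_trans sV; rewrite /W size_comp_poly2 //.
  by rewrite size_polyDl ?size_scale ?size_polyX ?size_polyC //; case: eqP.
have -> : (fun x => f x * V.[x]) =
    (fun x => \sum_(k < size W) W`_k * (f x * ((x - l) / (r - l)) ^+ k)).
  apply/funext => x; rewrite VE mulr_sumr; apply: eq_bigr => k _.
  by rewrite mulrCA.
rewrite cell_int_sum => [|k]; last first.
  exact/continuous_scale/continuous_mul/continuous_affX.
apply: big1 => k _; rewrite cell_intZ; last exact/continuous_mul/continuous_affX.
have /eqP := f0 k.+1 (leq_trans (ltn_ord k) sW).
rewrite /= mulf_eq0 invr_eq0 (negPf hN0) /= => /eqP ->.
by rewrite mulr0.
Qed.

(** An element of degree at most q orthogonal to all lower degrees and zero at
    an end c is (x - c) V with V of degree less than q, so it is orthogonal to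
    V, and (x - c) V ^ 2 has a sign. *)
Lemma radau_unisolvent q l r e p : l < r -> (size p <= q.+1)%N ->
  (forall k, (k <= q)%N -> radau_fun l r e k (horner p) = 0) -> p = 0.
Proof.
move=> lr sp p0; set c := radau_end e l r.
have /factor_theorem[V pV] : root p c by apply/rootP; exact: (p0 0%N).
have [V0|VN0] := eqVneq V 0; first by rewrite pV V0 mul0r.
have sV : (size V <= q)%N.
  by move: sp; rewrite pV size_Mmonic ?monicXsubC // size_XsubC addn2.
have := radau_fun_orth lr (@continuous_horner _ p) p0 sV.
have -> : (fun x => p.[x] * V.[x]) = horner (p * V).
  by apply/funext => x; rewrite hornerM.
rewrite {1}pV mulrAC => int0.
have sgn : (forall x, l < x < r -> 0 <= ((-1) ^+ e *: (V * V * ('X - c%:P))).[x]).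
  move=> x /andP[lx xr]; rewrite hornerZ !hornerM hornerXsubC mulrCA mulr_ge0 //.
    by rewrite -expr2 sqr_ge0.
  rewrite /c; case: (e) => /=; rewrite ?expr0 ?expr1 ?mul1r ?mulN1r; lra.
suff : (-1) ^+ e *: (V * V * ('X - c%:P)) = 0.
  move/eqP; rewrite scaler_eq0 signr_eq0 /= mulf_eq0 mulf_eq0 orbb (negPf VN0) /=.
  by rewrite polyXsubC_eq0.
apply: poly_int_eq0 lr sgn _.
rewrite (_ : horner _ = (fun x => (-1) ^+ e * (V * V * ('X - c%:P)).[x])).
  by rewrite cell_intZ ?int0 ?mulr0 //; exact: continuous_horner.
by apply/funext => x; rewrite hornerZ.
Qed.

Lemma cell_int_affine l r p : l < r ->
  cell_int l r (fun x => p.[(x - l) / (r - l)]) =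
  (r - l) * cell_int 0 1 (horner p).
Proof.
move=> lr; have hN0 : r - l != 0 by rewrite subr_eq0 gt_eqF.
have affE (P : {poly R}) x :
    P.[(x - l) / (r - l)] = (P \Po ((r - l)^-1 *: ('X - l%:P))).[x].
  by rewrite horner_comp hornerZ hornerXsubC mulrC.
rewrite (_ : (fun x => _) = horner (p \Po ((r - l)^-1 *: ('X - l%:P)))); last first.
  by apply/funext => x; rewrite affE.
pose F := (r - l) *: (primitive p \Po ((r - l)^-1 *: ('X - l%:P))).
transitivity (F.[r] - F.[l]).
  apply: (cell_int_FTC lr (@continuous_horner _ F) (@continuous_horner _ _)) => x _.
  have <- : F^`() = p \Po ((r - l)^-1 *: ('X - l%:P)).
    rewrite /F derivZ deriv_comp deriv_primitive derivZ derivXsubC.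
    by rewrite -scalerAr scalerA divff // scale1r mulr1.
  exact: is_derive_horner.
by rewrite /F !hornerZ -!affE cell_int_poly // subrr mul0r divff // mulrBr.
Qed.

Lemma radau_fun_affine l r e i p : l < r ->
  radau_fun l r e i (fun x => p.[(x - l) / (r - l)]) =
  radau_fun 0 1 e i (horner p).
Proof.
move=> lr; have hN0 : r - l != 0 by rewrite subr_eq0 gt_eqF.
case: i => [|k] /=; first by case: e; rewrite /= ?divff // subrr mul0r.
have -> : (fun x => p.[(x - l) / (r - l)] * ((x - l) / (r - l)) ^+ k) =
          (fun x => (p * 'X^k).[(x - l) / (r - l)]).
  by apply/funext => x; rewrite hornerM hornerXn.
rewrite cell_int_affine // mulKf // subr0 invr1 mul1r; congr cell_int.
by apply/funext => x; rewrite hornerM hornerXn subr0 mulr1.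
Qed.

Lemma radau_fun_norm_le l r e i f B : l < r -> continuous f -> 0 <= B ->
  (forall x, l <= x <= r -> `|f x| <= B) -> `|radau_fun l r e i f| <= B.
Proof.
move=> lr cf B0 fB; case: i => [|k] /=.
  by apply: fB; rewrite /radau_end; case: e; rewrite lexx ltW.
have h0 : 0 < r - l by rewrite subr_gt0.
rewrite normrM normfV (gtr0_norm h0) ler_pdivrMl // mulrC.
apply: cell_int_norm_le; [exact: ltW|exact/continuous_mul/continuous_affX|].
move=> x /andP[lx xr]; rewrite normrM -[leRHS]mulr1.
apply: ler_pM => //; first by rewrite fB // !ltW.
have y0 : 0 <= (x - l) / (r - l) by rewrite divr_ge0 ?subr_ge0 // ltW.
rewrite ger0_norm ?exprn_ge0 // exprn_ile1 // ler_pdivrMr // mul1r.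
by rewrite lerB // ltW.
Qed.

End RadauFunctionals.

(** * The Gauss-Radau projection and its error *)

Section RadauProjection.
Context {R : realType} (q : nat).
Implicit Types (l r : R) (e : bool) (f g : R -> R) (p : {poly R}).

Lemma radau_fun_lincomb l r e i (I : finType) (c : I -> R) (P : I -> {poly R}) :
  radau_fun l r e i (horner (\sum_j c j *: P j)) =
  \sum_j c j * radau_fun l r e i (horner (P j)).
Proof.
rewrite -radau_fun_sum; last by move=> j; exact: continuous_horner.
congr radau_fun; apply/funext => x; rewrite horner_sum.
by apply: eq_bigr => j _; rewrite hornerZ.
Qed.

(** Unisolvence makes the square matrix of the functionals on the monomials
    invertible; the rows of its inverse are the dual basis. *)
Lemma radau_basis_ex e : exists A : 'I_q.+1 -> {poly R},
  (forall i, (size (A i) <= q.+1)%N) /\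
  forall i k : 'I_q.+1, radau_fun 0 1 e k (horner (A i)) = (i == k)%:R.
Proof.
pose M : 'M[R]_q.+1 := \matrix_(i, k) radau_fun 0 1 e k (horner 'X^i).
pose P (v : 'rV[R]_q.+1) : {poly R} := \sum_i v 0 i *: 'X^i.
have sP v : (size (P v) <= q.+1)%N.
  apply: (leq_trans (size_sum _ _ _)); apply/bigmax_leqP => i _.
  by apply: (leq_trans (size_scale_leq _ _)); rewrite size_polyXn ltn_ord.
have funP v (k : 'I_q.+1) : radau_fun 0 1 e k (horner (P v)) = (v *m M) 0 k.
  by rewrite radau_fun_lincomb mxE; apply: eq_bigr => i _; rewrite mxE.
have Munit : M \in unitmx.
  rewrite -row_free_unit; apply/inj_row_free => v vM0.
  have P0 : P v = 0.
    apply: (@radau_unisolvent _ q 0 1 e) => // k kq.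
    by have /= -> := funP v (Ordinal (kq : (k < q.+1)%N)); rewrite vM0 mxE.
  apply/rowP => i; rewrite mxE.
  have /(congr1 (fun p : {poly R} => p`_i)) := P0; rewrite coef0 coef_sum.
  rewrite (bigD1 i) //= big1 ?addr0 => [|j ji]; last first.
    by rewrite coefZ coefXn eq_sym (inj_eq val_inj) (negPf ji) mulr0.
  by rewrite coefZ coefXn eqxx mulr1.
exists (fun i => P (row i (invmx M))); split => // i k.
by rewrite funP -row_mul mulVmx // row1 mxE eqxx eq_sym.
Qed.

Definition radau_basis e : 'I_q.+1 -> {poly R} := sval (cid (radau_basis_ex e)).

Lemma size_radau_basis e i : (size (radau_basis e i) <= q.+1)%N.
Proof. exact: (svalP (cid (radau_basis_ex e))).1. Qed.

Lemma radau_fun_basis e (i k : 'I_q.+1) :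
  radau_fun 0 1 e k (horner (radau_basis e i)) = (i == k)%:R.
Proof. exact: (svalP (cid (radau_basis_ex e))).2. Qed.

Definition cell_basis l r e i : {poly R} :=
  radau_basis e i \Po ((r - l)^-1 *: ('X - l%:P)).

Definition radau_proj l r e f : {poly R} :=
  \sum_(i < q.+1) radau_fun l r e i f *: cell_basis l r e i.

Lemma horner_cell_basis l r e i x :
  (cell_basis l r e i).[x] = (radau_basis e i).[(x - l) / (r - l)].
Proof. by rewrite horner_comp hornerZ hornerXsubC mulrC. Qed.

Lemma horner_radau_proj l r e f x : (radau_proj l r e f).[x] =
  \sum_(i < q.+1) radau_fun l r e i f * (cell_basis l r e i).[x].
Proof. by rewrite horner_sum; apply: eq_bigr => i _; rewrite hornerZ. Qed.

Lemma size_radau_proj l r e f : (size (radau_proj l r e f) <= q.+1)%N.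
Proof.
apply: (leq_trans (size_sum _ _ _)); apply/bigmax_leqP => i _.
apply: (leq_trans (size_scale_leq _ _)).
apply: leq_trans (size_radau_basis e i); rewrite /cell_basis.
have [->|bN0] := eqVneq (radau_basis e i) 0; first by rewrite comp_poly0.
apply: (leq_trans (size_comp_poly_leq _ _)).
have sX : ((size ((r - l)^-1 *: ('X - l%:P))).-1 <= 1)%N.
  have := size_scale_leq (r - l)^-1 ('X - l%:P); rewrite size_XsubC.
  by case: size => // -[].
move: bN0; rewrite -size_poly_eq0; case: size => // n _.
by rewrite ltnS -[leqRHS]muln1 leq_mul2l sX orbT.
Qed.

Lemma radau_fun_proj l r e f k : l < r -> (k <= q)%N ->
  radau_fun l r e k (horner (radau_proj l r e f)) = radau_fun l r e k f.
Proof.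
move=> lr kq; rewrite radau_fun_lincomb.
pose k' := Ordinal (kq : (k < q.+1)%N).
have basisE i : radau_fun l r e k (horner (cell_basis l r e i)) = (i == k')%:R.
  rewrite -(radau_fun_basis e) -(radau_fun_affine e k' (radau_basis e i) lr).
  by congr radau_fun; apply/funext => x; exact: horner_cell_basis.
rewrite (bigD1 k') //= basisE eqxx mulr1 big1 ?addr0 // => i ik.
by rewrite basisE (negPf ik) mulr0.
Qed.

Lemma radau_proj_end l r e f : l < r ->
  (radau_proj l r e f).[radau_end e l r] = f (radau_end e l r).
Proof. by move=> lr; exact: (@radau_fun_proj l r e f 0%N lr). Qed.

Lemma radau_proj_orth l r e f (V : {poly R}) :
  l < r -> continuous f -> (size V <= q)%N ->
  cell_int l r (fun x => ((radau_proj l r e f).[x] - f x) * V.[x]) = 0.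
Proof.
move=> lr cf; apply: (radau_fun_orth (e := e) lr).
  exact/continuous_sub/cf/continuous_horner.
move=> k kq; rewrite radau_funB //; last exact: continuous_horner.
by rewrite radau_fun_proj // subrr.
Qed.

Lemma radau_proj_unique l r e f p : l < r -> continuous f ->
  (size p <= q.+1)%N -> p.[radau_end e l r] = f (radau_end e l r) ->
  (forall V : {poly R}, (size V <= q)%N ->
     cell_int l r (fun x => (p.[x] - f x) * V.[x]) = 0) ->
  p = radau_proj l r e f.
Proof.
move=> lr cf sp pend porth; apply/eqP; rewrite -subr_eq0; apply/eqP.
apply: (@radau_unisolvent _ q l r e) => //.
  by rewrite (leq_trans (size_polyD _ _)) // size_polyN geq_max sp size_radau_proj.
move=> k kq; rewrite (_ : horner _ = fun x => p.[x] - (radau_proj l r e f).[x]); last first.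
  by apply/funext => x; rewrite hornerD hornerN.
rewrite radau_funB; [|exact: continuous_horner..].
rewrite radau_fun_proj //; apply/eqP; rewrite subr_eq0.
case: k kq => [|k] kq /=; first by rewrite pend.
apply/eqP; congr (_ * _).
pose V : {poly R} := ((r - l)^-1 *: ('X - l%:P)) ^+ k.
have VE x : V.[x] = ((x - l) / (r - l)) ^+ k.
  by rewrite horner_exp hornerZ hornerXsubC mulrC.
have sV : (size V <= q)%N.
  apply: (leq_trans (size_exp_leq _ _)); apply: leq_ltn_trans kq.
  rewrite -[leqRHS]mul1n leq_mul2r; apply/orP; right.
  have := size_scale_leq (r - l)^-1 ('X - l%:P); rewrite size_XsubC.
  by case: size => // -[].
have := porth V sV; under eq_cell_int => x _ do rewrite VE mulrBl.
rewrite cell_intB; [|exact/continuous_mul/continuous_affX/continuous_horner|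
  exact/continuous_mul/continuous_affX].
by move/eqP; rewrite subr_eq0 => /eqP.
Qed.

(** The projection is stable in the maximum norm with a constant that depends
    only on the degree: the sum of the absolute values of the coefficients of
    the reference basis. *)
Definition radau_cst e : R :=
  \sum_(i < q.+1) \sum_(k < size (radau_basis e i)) `|(radau_basis e i)`_k|.

Lemma radau_cst_ge0 e : 0 <= radau_cst e.
Proof. by apply: sumr_ge0 => i _; apply: sumr_ge0 => k _. Qed.

Lemma radau_proj_norm_le l r e f B : l < r -> continuous f -> 0 <= B ->
  (forall x, l <= x <= r -> `|f x| <= B) ->
  forall x, l <= x <= r -> `|(radau_proj l r e f).[x]| <= radau_cst e * B.
Proof.
move=> lr cf B0 fB x /andP[lx xr]; rewrite horner_radau_proj.
rewrite (le_trans (ler_norm_sum _ _ _)) // mulr_suml; apply: ler_sum => i _.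
rewrite normrM mulrC; apply: ler_pM => //; last exact: radau_fun_norm_le.
rewrite horner_cell_basis horner_coef (le_trans (ler_norm_sum _ _ _)) //.
apply: ler_sum => k _; rewrite normrM -[leRHS]mulr1 ler_wpM2l //.
have h0 : 0 < r - l by rewrite subr_gt0.
have y0 : 0 <= (x - l) / (r - l) by rewrite divr_ge0 ?subr_ge0 // ltW.
rewrite ger0_norm ?exprn_ge0 // exprn_ile1 // ler_pdivrMr // mul1r.
by rewrite lerB.
Qed.

(** Repeated integration makes the derivative and the degree immediate, and spares the
    factorials. *)
Fixpoint taylor_poly l n (c : nat -> R) : {poly R} :=
  if n is m.+1 then
    let P := primitive (taylor_poly l m (c \o succn)) in P + (c 0%N - P.[l])%:P
  else 0.

Lemma size_taylor_poly l n c : (size (taylor_poly l n c) <= n)%N.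
Proof.
elim: n c => [|n IHn] c; first by rewrite size_poly0.
rewrite (leq_trans (size_polyD _ _)) // geq_max (leq_trans (size_polyC_leq1 _)) //.
by rewrite andbT (leq_trans (size_poly _ _)) // ltnS IHn.
Qed.

(** The factor 1 / n! is given up: the mean value theorem then suffices. *)
Lemma taylor_remainder n l r (G : nat -> R -> R) M : l < r ->
  (forall i, continuous (G i)) ->
  (forall i x, l < x < r -> is_derive x 1 (G i) (G i.+1 x)) ->
  (forall x, l <= x <= r -> `|G n x| <= M) ->
  forall x, l <= x <= r ->
  `|G 0%N x - (taylor_poly l n (G ^~ l)).[x]| <= M * (x - l) ^+ n.
Proof.
move=> lr; elim: n G => [|n IHn] G cG dG GM x lxr.
  by rewrite horner0 subr0 mulr1 GM.
have M0 : 0 <= M by apply: le_trans (GM l _); rewrite // lexx ltW.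
set T := taylor_poly l n.+1 _.
have T' : T^`() = taylor_poly l n ((fun i => G i.+1) ^~ l).
  by rewrite /T /= derivD derivC addr0 deriv_primitive.
have Tl : T.[l] = G 0%N l by rewrite /T /= hornerD hornerC addrC subrK.
have [lx xr] := andP lxr.
have [||c lcx /=] := @mean_value R l x (fun y => G 0%N y - T.[y])
    (fun y => G 1%N y - T^`().[y]) lx.
- exact/continuous_sub/continuous_horner.
- move=> y /andP[ly yx].
  apply: is_deriveB.
  by apply: dG; rewrite ly (lt_le_trans yx).
rewrite Tl subrr subr0 => ->.
have [lc cx] := andP lcx.
rewrite normrM exprSr mulrA (@ger0_norm _ (x - l)) ?subr_ge0 //.
rewrite ler_wpM2r ?subr_ge0 // T'.
apply: le_trans (IHn (fun i => G i.+1) _ _ _ _ _) _ => //.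
  by rewrite lc (le_trans cx).
by rewrite ler_wpM2l // lerXn2r ?nnegrE ?subr_ge0 // lerB.
Qed.

(** The projection reproduces the Taylor polynomial, so its error is that of the
    remainder, which the stability estimate controls. *)
Lemma radau_proj_error l r e (G : nat -> R -> R) M : l < r ->
  (forall i, continuous (G i)) ->
  (forall i x, l < x < r -> is_derive x 1 (G i) (G i.+1 x)) ->
  (forall x, l <= x <= r -> `|G q.+1 x| <= M) ->
  forall x, l <= x <= r ->
  `|(radau_proj l r e (G 0%N)).[x] - G 0%N x|
    <= (radau_cst e + 1) * (M * (r - l) ^+ q.+1).
Proof.
move=> lr cG dG GM x lxr.
have M0 : 0 <= M by apply: le_trans (GM l _); rewrite // lexx ltW.
have h0 : 0 < r - l by rewrite subr_gt0.
pose T := taylor_poly l q.+1 (G ^~ l).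
pose rem x := G 0%N x - T.[x].
have crem : continuous rem by exact/continuous_sub/continuous_horner.
have remB y : l <= y <= r -> `|rem y| <= M * (r - l) ^+ q.+1.
  move=> lyr; have [ly yr] := andP lyr.
  apply: le_trans (taylor_remainder lr cG dG GM lyr) _.
  by rewrite ler_wpM2l // lerXn2r ?nnegrE ?subr_ge0 ?lerB // ltW.
have projT : radau_proj l r e (horner T) = T.
  apply/esym/radau_proj_unique => //; first exact: continuous_horner.
    exact: size_taylor_poly.
  move=> V _; rewrite -(cell_int0 l r); apply: eq_cell_int => y _.
  by rewrite subrr mul0r.
have -> : (radau_proj l r e (G 0%N)).[x] = (radau_proj l r e rem).[x] + T.[x].
  rewrite -projT !horner_radau_proj -big_split /=; apply: eq_bigr => i _.
  rewrite radau_funB //; last exact: continuous_horner.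
  by rewrite -mulrDl subrK.
have -> : (radau_proj l r e rem).[x] + T.[x] - G 0%N x =
    (radau_proj l r e rem).[x] - rem x by rewrite /rem; ring.
rewrite mulrDl mul1r (le_trans (ler_normB _ _)) // lerD ?remB //.
apply: radau_proj_norm_le => //.
by rewrite mulr_ge0 // exprn_ge0 // ltW.
Qed.

End RadauProjection.

(** * Functions of space and time *)

Section Joint.
Context {R : realType}.
Implicit Types (a b c d l r x t : R) (u v : R -> R -> R).
Notation mu := (@lebesgue_measure R).

Definition jointly_continuous u := continuous (fun p : R * R => u p.1 p.2).

Lemma jointly_continuous_comp (S : topologicalType) u (f g : S -> R) :
  jointly_continuous u -> continuous f -> continuous g ->
  continuous (fun s => u (f s) (g s)).
Proof.
by move=> cu cf cg s; apply: (cvg_comp2 (cf s) (cg s)); exact: (cu (f s, g s)).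
Qed.

Lemma jointly_continuous_swap u :
  jointly_continuous u -> jointly_continuous (fun t x => u x t).
Proof.
by move=> cu; apply: jointly_continuous_comp cu _ _ => p;
  [exact: cvg_snd|exact: cvg_fst].
Qed.

Lemma jointly_continuous_left u t : jointly_continuous u -> continuous (u ^~ t).
Proof.
by move=> cu; apply: jointly_continuous_comp cu _ _ => x;
  [exact: cvg_id|exact: cvg_cst].
Qed.

Lemma jointly_continuous_right u x : jointly_continuous u -> continuous (u x).
Proof. by move=> cu; exact: jointly_continuous_left (jointly_continuous_swap cu). Qed.

Lemma near_meets_oo a b x (P : set R) : a < b -> a <= x <= b ->
  (\forall y \near x, P y) -> exists2 y, a < y < b & P y.
Proof.
move=> ab /andP[ax xb] /nbhs_ballP[e /= e0 eP].
pose m := Num.min (e / 2) ((b - a) / 4).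
have m0 : 0 < m by rewrite lt_min !divr_gt0 ?subr_gt0.
have me : m <= e / 2 by rewrite ge_min lexx.
have mab : m <= (b - a) / 4 by rewrite ge_min lexx orbT.
have [xm|xm] := lerP x ((a + b) / 2).
  exists (x + m); first by apply/andP; split; lra.
  apply: eP; rewrite /ball /= opprD addNKr normrN gtr0_norm //; lra.
exists (x - m); first by apply/andP; split; lra.
apply: eP; rewrite /ball /= opprB addrCA subrr addr0 gtr0_norm //; lra.
Qed.

(** A partial derivative known in the open strip persists on its closure: by the
    mean value theorem the difference quotients are close to the derivative
    uniformly in the parameter. *)
Lemma is_derive_boundary a b c d u v x t : a < b ->
  jointly_continuous u -> jointly_continuous v ->
  (forall y s, a < y < b -> c < s < d -> is_derive s 1 (u y) (v y s)) ->
  a <= x <= b -> c < t < d -> is_derive t 1 (u x) (v x t).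
Proof.
move=> ab cu cv duv xab tcd.
suff H : h^-1 *: (u x (h *: 1 + t) - u x t) @[h --> 0^'] --> v x t.
  apply: DeriveDef; first by apply/cvg_ex; exists (v x t).
  exact: cvg_lim.
apply/cvgrPdist_le => /= e e0.
have /= := cv (x, t); move/cvgrPdist_le => /(_ e e0) /nbhs_ballP[del /= del0 vdel].
have [ct td] := andP tcd.
near=> h.
have hN0 : h != 0 by near: h; exact: nbhs_dnbhs_neq.
have hdel : `|h| < del by near: h; apply: dnbhs0_lt.
have hc : `|h| < t - c by near: h; apply: dnbhs0_lt; rewrite subr_gt0.
have hd : `|h| < d - t by near: h; apply: dnbhs0_lt; rewrite subr_gt0.
rewrite scaler1.
suff : `|h * v x t - (u x (h + t) - u x t)| <= e * `|h|.
  move=> H; rewrite -[v x t](mulKf hN0) -mulrBr normrM normfV.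
  by rewrite ler_pdivrMl ?normr_gt0 // [leRHS]mulrC.
pose k y := `|h * v x t - (u y (h + t) - u y t)|.
have kle y : a < y < b -> `|y - x| < del -> k y <= e * `|h|.
  move=> yab yx.
  have mv s1 s2 : c < s1 -> s1 <= s2 -> s2 < d ->
      exists2 s, s1 <= s <= s2 & u y s2 - u y s1 = v y s * (s2 - s1).
    move=> cs1 s12 s2d; apply: mean_value => //; first exact: jointly_continuous_right.
    move=> s /andP[s1s ss2]; apply: duv => //.
    by rewrite (lt_trans cs1 s1s) (lt_trans ss2 s2d).
  have [s st E] : exists2 s, `|s - t| < del & u y (h + t) - u y t = h * v y s.
    have [h0|h0] := leP 0 h.
      rewrite ger0_norm // in hdel hc hd.
      have [||s /andP[ts sh] ->] := mv t (h + t) ct; [lra..|].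
      by exists s; [rewrite ger0_norm; lra|ring].
    rewrite ltr0_norm // in hdel hc hd.
    have [|||s /andP[ts sh] E] := mv (h + t) t; [lra..|].
    by exists s; [rewrite ler0_norm; lra|rewrite -[LHS]opprB E; ring].
  rewrite /k E -mulrBr normrM mulrC ler_wpM2r //.
  have := vdel (y, s); apply; split; rewrite /ball /= distrC //.
rewrite leNgt; apply/negP => kgt.
have ck : continuous k.
  have cB : continuous (fun y => u y (h + t) - u y t).
    by apply: continuous_sub => ?; exact: jointly_continuous_left.
  by move=> y; apply: cvg_norm; apply: cvgB; [exact: cvg_cst|exact: cB].
have [] := @near_meets_oo a b x [set y | `|y - x| < del /\ e * `|h| < k y] ab xab.
  near=> y; split.
    by near: y; apply/nbhs_ballP; exists del => //= y; rewrite /ball /= distrC.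
  by near: y; exact: (cvgr_gt _ (ck x)).
by move=> y yab [yx]; rewrite ltNge kle.
Unshelve. all: by end_near. Qed.

(** Differentiation under the integral sign, with a constant as dominating function. *)
Lemma is_derive_cell_int l r c d u v B t :
  jointly_continuous u -> jointly_continuous v ->
  (forall y s, l < y < r -> c < s < d -> is_derive s 1 (u y) (v y s)) ->
  (forall y s, l < y < r -> `|v y s| <= B) ->
  c < t < d ->
  is_derive t 1 (fun s => cell_int l r (u ^~ s)) (cell_int l r (v ^~ t)).
Proof.
move=> cu cv duv vB tcd.
pose f s y := u y s.
have It : t \in `]c, d[%classic by rewrite inE /= in_itv.
have intf s : `]c, d[%classic s -> mu.-integrable `]l, r[ (EFin \o f s).
  by move=> _; apply: integrable_cell; exact: jointly_continuous_left.
have drv s y : `]c, d[%classic s -> `]l, r[%classic y -> is_derive s 1 (f ^~ y) (v y s).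
  by rewrite /= !in_itv /= => scd ylr; exact: duv.
have der s y : `]c, d[%classic s -> `]l, r[%classic y -> derivable (f ^~ y) s 1.
  by move=> /drv/[apply] -[].
have G0 (y : R) : 0 <= `|B| by [].
have intG : mu.-integrable `]l, r[ (EFin \o (fun=> `|B|)).
  by apply: integrable_cell => y; exact: cvg_cst.
have dE s y : `]c, d[%classic s -> `]l, r[%classic y -> partial1of2 f s y = v y s.
  by move=> Is Iy; rewrite partial1of2E; have dd := drv _ _ Is Iy; exact: derive_val.
have G_ub s y : `]c, d[%classic s -> `]l, r[%classic y ->
    `|partial1of2 f s y| <= `|B|.
  by move=> Is Iy; rewrite dE // (le_trans (vB y s _)) ?ler_norm.
move/set_mem: It => It; apply: DeriveDef.
  have := @derivable_under_integral R _ _ mu f _ (measurable_itv `]l, r[) _ _ _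
    It intf der _ G0 intG G_ub.
  exact.
rewrite -derive1E.
have := @differentiation_under_integral R _ _ mu f _ (measurable_itv `]l, r[) _ _ _
    It intf der _ G0 intG G_ub.
rewrite -[(fun s => _)]/(fun s => cell_int l r (u ^~ s)) => ->.
by apply: eq_Rintegral => y /set_mem Iy; rewrite dE.
Qed.

Lemma continuous_cell_int l r u B : jointly_continuous u ->
  (forall y s, l < y < r -> `|u y s| <= B) ->
  continuous (fun s => cell_int l r (u ^~ s)).
Proof.
move=> cu uB t.
have intf s : `]t - 1, t + 1[%classic s ->
    mu.-integrable `]l, r[ (EFin \o (fun s y => u y s) s).
  by move=> _; apply: integrable_cell; exact: jointly_continuous_left.
apply: (@continuity_under_integral _ _ _ mu (fun s y => u y s) _ (measurable_itv _)
   (t - 1) (t + 1) intf _ (fun=> B)).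
- by apply: aeW => y _ s _; exact: jointly_continuous_right.
- by apply: integrable_cell => y; exact: cvg_cst.
- by move=> s _; apply: aeW => y; rewrite /= in_itv /=; exact: uB.
- by rewrite inE /= in_itv /= ltrBlDr !ltrDl ltr01.
Qed.

End Joint.

(** * Extension of the smooth solution to the plane *)

Section SmoothExtension.
Context {R : realType}.
Implicit Types (a b x t T : R) (w : R -> R -> R) (D : nat -> nat -> R -> R -> R).

Definition clamp a b x : R := Num.max a (Num.min b x).

Lemma continuous_clamp a b : continuous (clamp a b).
Proof.
by move=> x; apply: continuous_max; [exact: cvg_cst|apply: continuous_min;
  [exact: cvg_cst|exact: cvg_id]].
Qed.

Lemma clamp_itv a b x : a <= b -> a <= clamp a b x <= b.
Proof. by move=> ab; rewrite /clamp le_max lexx ge_max ab ge_min lexx. Qed.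

Lemma clampE a b x : a <= x <= b -> clamp a b x = x.
Proof.
move=> /andP[ax xb]; rewrite /clamp; have -> : Num.min b x = x by exact: min_r.
exact: max_r.
Qed.

(** The derivatives of a smooth function, prolonged to the whole plane so that their
    continuity and integrability need no mention of the boundary. The derivatives along
    one variable hold up to the boundary in the other: the trace at an end of the
    interval is differentiated in time, and the solution is expanded in space at
    the final time. *)
Definition smooth_family a b T D : Prop :=
  [/\ forall i j, jointly_continuous (D i j),
      forall i j, exists B, forall x t, `|D i j x t| <= B,
      forall i j x t, a < x < b -> 0 <= t <= T ->
        is_derive x 1 (D i j ^~ t) (D i.+1 j x t) &
      forall i j x t, a <= x <= b -> 0 < t < T ->
        is_derive t 1 (D i j x) (D i j.+1 x t)].

Lemma smooth_on_family a b T w : a < b -> 0 < T -> smooth_on a b T w ->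
  exists2 D, smooth_family a b T D &
    forall x t, a <= x <= b -> 0 <= t <= T -> D 0%N 0%N x t = w x t.
Proof.
move=> ab T0 [D [D00 cD dD]].
(* Constant prolongation along each axis; it agrees with D near interior points. *)
pose E i j x t := D i j (clamp a b x) (clamp 0 T t).
have EE i j x t : a <= x <= b -> 0 <= t <= T -> E i j x t = D i j x t.
  by move=> xab tT; rewrite /E !clampE.
have cE i j : jointly_continuous (E i j).
  move=> [x t]; pose g (p : R * R) := (clamp a b p.1, clamp 0 T p.2).
  have cg : g p @[p --> (x, t)] --> g (x, t).
    apply: (@cvg_pair _ _ _ _ (nbhs (clamp a b x)) (nbhs (clamp 0 T t))).
      apply: (@continuous_comp _ _ _ fst (clamp a b) (x, t)).
        exact: cvg_fst.
      exact: continuous_clamp.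
    apply: (@continuous_comp _ _ _ snd (clamp 0 T) (x, t)).
      exact: cvg_snd.
    exact: continuous_clamp.
  have /subspace_continuousP/(_ (g (x, t))) := cD i j.
  have gin p : (`[a, b] `*` `[0, T])%classic (g p).
    by split; rewrite /= in_itv /= clamp_itv // ltW.
  move=> /(_ (gin _)) cDg; apply: cvg_trans cDg => /= A.
  move=> /cg gA; change (nbhs (x, t) (fun p : R * R => A (E i j p.1 p.2))).
  apply: (@filterS _ (nbhs (x, t)) _ _ _ _ gA) => p; apply; exact: gin.
exists E; last by move=> x t xab tT; rewrite EE // D00.
have dEx i j x t : a < x < b -> 0 < t < T -> is_derive x 1 (E i j ^~ t) (E i.+1 j x t).
  move=> /andP[ax xb] /andP[t0 tT]; rewrite EE ?ltW //.
  have [||dx _] := dD i j x t; [by rewrite in_itv /= ax xb|by rewrite in_itv /= t0 tT|].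
  apply: (near_eq_is_derive _ dx); near=> y.
  have ay : a < y by near: y; exact: lt_nbhsr.
  have yb : y < b by near: y; exact: lt_nbhsl.
  by rewrite EE ?ltW.
have dEt i j x t : a < x < b -> 0 < t < T -> is_derive t 1 (E i j x) (E i j.+1 x t).
  move=> /andP[ax xb] /andP[t0 tT]; rewrite EE ?ltW //.
  have [||_ dt] := dD i j x t; [by rewrite in_itv /= ax xb|by rewrite in_itv /= t0 tT|].
  apply: (near_eq_is_derive _ dt); near=> y.
  have y0 : 0 < y by near: y; exact: lt_nbhsr.
  have yT : y < T by near: y; exact: lt_nbhsl.
  by rewrite EE ?ltW.
split => //.
- move=> i j.
  have cptK : compact (`[a, b] `*` `[0, T] : set (R * R)).
    by apply: compact_setX; exact: segment_compact.
  have rect0 : (`[a, b] `*` `[0, T] : set (R * R)) !=set0.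
    by exists (a, 0); split; rewrite /= in_itv /= lexx ltW.
  have cN : {within `[a, b] `*` `[0, T],
      continuous (fun p : R * R => `|D i j p.1 p.2|)}.
    by move=> p; apply: continuous_comp; [exact: cD|exact: norm_continuous].
  have [p _ pmax] := compact_EVT_max rect0 cptK cN.
  exists `|D i j p.1 p.2| => x t; apply: (pmax (clamp a b x, clamp 0 T t)).
  by apply/mem_set; split; rewrite /= in_itv /= clamp_itv // ltW.
- move=> i j x t xab tT.
  apply: (@is_derive_boundary _ 0 T a b (fun t x => E i j x t)
    (fun t x => E i.+1 j x t)) => //; try exact: jointly_continuous_swap.
  by move=> s y sT yab; exact: dEx.
- move=> i j x t xab tT.
  by apply: (@is_derive_boundary _ a b 0 T (E i j) (E i j.+1)).
Unshelve. all: by end_near. Qed.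

End SmoothExtension.

(** * Derivatives bounded almost everywhere *)

Section Lipschitz.
Context {R : realType}.
Implicit Types (a b c x y s z : R) (f g : R -> R).
Notation mu := (@lebesgue_measure R).

(** Compactness of the interval: the supremum of the points [z] with [P a z] has a
    neighbourhood on which [P] holds, so it can only be [b]. *)
Lemma cousin (P : R -> R -> Prop) a b : a <= b ->
  (forall x, a <= x <= b -> exists2 d, 0 < d &
     forall s z, a <= s -> s <= x -> x <= z -> z <= b -> z - s < d -> P s z) ->
  (forall s m z, s <= m -> m <= z -> P s m -> P m z -> P s z) -> P a b.
Proof.
move=> ab loc cat.
pose A : set R := [set z | a <= z <= b /\ P a z].
have Aa : A a.
  split; first by rewrite lexx.
  have [|d d0 Pd] := loc a; first by rewrite lexx.
  by apply: Pd; rewrite ?subrr.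
have hA : has_sup A by split; [exists a|exists b => z [/andP[_]]].
have ac : a <= sup A by apply: ub_le_sup => //; case: hA.
have cb : sup A <= b by apply: ge_sup; [exists a|move=> z [/andP[]]].
have [|d d0 Pd] := loc (sup A); first by rewrite ac.
have d2 : 0 < d / 2 by rewrite divr_gt0.
have [z0 [/andP[az0 z0b] Pz0] cz0] := sup_adherent d2 hA.
have z0c : z0 <= sup A.
  by apply: ub_le_sup; [case: hA|split; rewrite ?az0].
pose z1 := Num.min b (sup A + d / 2).
have z1b : z1 <= b by rewrite ge_min lexx.
have z1d : z1 <= sup A + d / 2 by rewrite ge_min lexx orbT.
have cz1 : sup A <= z1 by rewrite le_min cb /=; lra.
have Pz1 : P a z1.
  apply: (cat a z0 z1) => //; first exact: le_trans cz1.
  by apply: Pd => //; lra.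
have : z1 <= sup A.
  apply: ub_le_sup; first by case: hA.
  by split => //; rewrite z1b (le_trans ac).
rewrite {1}/z1 ge_min => /orP[bc|]; last lra.
suff <- : z1 = b by [].
by apply/eqP; rewrite eq_le z1b (le_trans bc).
Qed.

Lemma null_open_cover (N : set R) (e : R) : 0 < e -> measurable N -> mu N = 0%E ->
  exists U : set R, [/\ open U, N `<=` U & (mu U <= e%:E)%E].
Proof.
move=> e0 mN N0.
have [|U [oU NU UN]] := @lebesgue_regularity_outer R N e mN _ e0.
  by rewrite [ltLHS]N0 ltry.
exists U; split => //.
have mU : measurable U by exact: open_measurable.
rewrite -(setDUK NU) (le_trans (measureU2 _ _ _)) //; first exact: measurableD.
by rewrite [X in (X + _)%E]N0 add0e ltW.
Qed.

(** The derivative is controlled outside a null set N only. The monotone function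
    z |-> sum_n |G n `&` ]a, z]|, for open G n containing N with small total measure,
    is small, yet has infinite derivative at each point of N: added to the linear
    bound, it dominates the growth of f near every point, with no exception, and
    local domination propagates to intervals. *)
Lemma derive_ae_le f f' c a b (N : set R) : 0 <= c -> a <= b ->
  (forall x, is_derive x 1 f (f' x)) -> measurable N -> mu N = 0%E ->
  (forall x, ~ N x -> f' x <= c) -> f b - f a <= c * (b - a).
Proof.
move=> c0 ab df mN N0 f'c.
apply/ler_addgt0Pr => e0 e0_gt0.
(* The error e is spent on the interval, e (b - a), and on the covers, e. *)
pose e := e0 / (b - a + 1).
have ba1 : 0 < b - a + 1 by rewrite ltr_wpDl ?subr_ge0.
have e_gt0 : 0 < e by rewrite divr_gt0.
have /choice[G GP] : forall n : nat, exists U : set R,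
    [/\ open U, N `<=` U & (mu U <= (e / (2 ^ n.+1)%:R)%:E)%E].
  by move=> n; apply: null_open_cover => //; rewrite divr_gt0 ?ltr0n ?expn_gt0.
have mG n : measurable (G n) by apply: open_measurable; case: (GP n).
have mGI n s z : measurable (G n `&` `]s, z]).
  by apply: measurableI; [exact: mG|exact: measurable_itv].
pose tau s z : \bar R := (\sum_(n <oo) mu (G n `&` `]s, z]))%E.
have tau_ge0 s z : (0 <= tau s z)%E by apply: nneseries_ge0 => n _ _.
have tauD s m z : s <= m -> m <= z -> (tau s m + tau m z <= tau s z)%E.
  move=> sm mz; rewrite /tau -nneseriesD //.
  apply: lee_nneseries => [n _ _|n _]; first by rewrite adde_ge0.
  have disj : (G n `&` `]s, m]) `&` (G n `&` `]m, z]) = set0.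
    apply/seteqP; split => // x [[_ /=]]; rewrite in_itv /= => /andP[_ xm] [_ /=].
    by rewrite in_itv /= ltNge xm.
  rewrite -measureU //; [|exact: mGI..].
  apply: le_measure; rewrite ?inE //.
  - by apply: measurableU; exact: mGI.
  - exact: mGI.
  rewrite -setIUr; apply: setIS => x [] /=; rewrite !in_itv /= => /andP[p1 p2].
    by apply/andP; split; lra.
  by apply/andP; split; lra.
have tau_le : (tau a b <= e%:E)%E.
  apply: le_trans (epsilon_trick0 xpredT (ltW e_gt0)).
  apply: lee_nneseries; first by [].
  move=> k _; have [_ _ Gk] := GP k; apply: (@le_trans _ _ (mu (G k))); last exact: Gk.
  by apply: le_measure; rewrite ?inE //; first [exact: mGI|exact: mG|exact: subIsetl].
have tau_ge x (K : nat) : N x -> exists2 d, 0 < d & forall s z, s <= x -> x <= z ->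
    z - s < d -> ((K%:R * (z - s))%:E <= tau s z)%E.
  move=> Nx.
  have [d d0 dG] : exists2 d, 0 < d & forall n, (n < K)%N -> forall y, `|x - y| < d -> G n y.
    have /nbhs_ballP[d /= d0 dG] : \forall y \near x, forall i : 'I_K, G i y.
      apply: (@filter_forall _ _ (fun i : 'I_K => G i) (nbhs x)) => i.
      have [oG NG _] := GP i.
      exact: (open_nbhs_nbhs (conj oG (NG _ Nx))).
    exists d => // n nK y xy; have := dG y; rewrite /ball /= => /(_ xy).
    by move/(_ (Ordinal nK)).
  exists d => // s z sx xz zsd.
  apply: (@le_trans _ _ (\sum_(0 <= n < K) mu (G n `&` `]s, z]))%E); last first.
    by apply: nneseries_lim_ge => n _ _; exact: measure_ge0.
  rewrite (eq_big_nat _ _ (F2 := fun=> (z - s)%:E)) => [|n nK]; last first.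
    have -> : G n `&` `]s, z] = `]s, z]%classic.
      apply/seteqP; split => [y []//|y ysz]; split => //.
      move: ysz; rewrite /= in_itv /= => /andP[sy yz].
      by apply: dG => //; rewrite ltr_norml; apply/andP; split; lra.
    rewrite /= lebesgue_measure_itv /= lte_fin; case: ltP => // zs.
    have -> : z = s by apply/eqP; rewrite eq_le zs (le_trans sx).
    by rewrite subrr.
  by rewrite sumEFin sumr_const_nat subn0 mulr_natl.
pose P s z := ((f z - f s)%:E <= ((c + e) * (z - s))%:E + tau s z)%E.
suff : P a b.
  move=> /le_trans/(_ (leeD2l _ tau_le)); rewrite -EFinD lee_fin => /le_trans; apply.
  by rewrite mulrDl -addrA lerD2l -{2}[e]mulr1 -mulrDr /e divfK // gt_eqF.
apply: (cousin (P := P) ab) => [x _|s m z sm mz Psm Pmz]; last first.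
  have fE : f z - f s = (f m - f s) + (f z - f m) by ring.
  have zE : (c + e) * (z - s) = (c + e) * (m - s) + (c + e) * (z - m) by ring.
  rewrite /P fE zE !EFinD; apply: le_trans (leeD Psm Pmz) _.
  by rewrite addeACA leeD2l // tauD.
have [d d0 dfx] : exists2 d, 0 < d & forall y, `|x - y| < d ->
    `|f y - f x - f' x * (y - x)| <= e * `|y - x|.
  have [fx <-] := df x.
  have /cvgrPdist_le/(_ e e_gt0) : h^-1 *: (f (h *: 1 + x) - f x) @[h --> 0^'] --> 'D_1 f x.
    exact: fx.
  move=> /nbhs_ballP[d /= d0 H]; exists d => // y xy.
  have [->|yx] := eqVneq y x; first by rewrite !subrr mulr0 subr0 normr0 mulr0.
  have yx0 : y - x != 0 by rewrite subr_eq0.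
  have := H (y - x); rewrite /ball /= sub0r normrN distrC => /(_ xy yx0).
  rewrite scaler1 subrK distrC => H1.
  have -> : f y - f x - 'D_1 f x * (y - x) =
     (y - x) * ((y - x)^-1 *: (f y - f x) - 'D_1 f x).
    have E : (y - x) * ((y - x)^-1 *: (f y - f x)) = f y - f x by exact: mulVKf.
    by rewrite [RHS]mulrBr E ['D_1 f x * _]mulrC.
  by rewrite normrM mulrC ler_wpM2r // distrC.
have growth s z : s <= x -> x <= z -> z - s < d -> f z - f s <= (f' x + e) * (z - s).
  move=> sx xz zsd.
  have zxE : `|z - x| = z - x by rewrite ger0_norm // subr_ge0.
  have sxE : `|x - s| = x - s by rewrite ger0_norm // subr_ge0.
  have := dfx z; rewrite [`|x - z|]distrC zxE => /(_ ltac:(lra))/ler_normlW Hz.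
  have := dfx s; rewrite [`|s - x|]distrC sxE => /(_ ltac:(lra)).
  rewrite ler_norml => /andP[Hs _].
  lra.
have [Nx|Nx] := pselect (N x); last first.
  exists d => // s z _ sx xz _ zsd; rewrite /P -[leLHS]adde0 leeD // lee_fin.
  apply: (le_trans (growth s z sx xz zsd)).
  by rewrite ler_wpM2r ?subr_ge0 ?(le_trans sx) // lerD2r f'c.
(* At a point of N the derivative is finite, so finitely many covers absorb it. *)
have [K f'K] : exists K : nat, f' x <= K%:R.
  by exists (Num.bound `|f' x|); rewrite (le_trans (ler_norm _)) // ltW // archi_boundP.
have [d' d'0 tauK] := tau_ge x K Nx.
exists (Num.min d d'); first by rewrite lt_min d0.
move=> s z _ sx xz _; rewrite lt_min => /andP[zsd zsd'].
have sz : 0 <= z - s by rewrite subr_ge0 (le_trans sx).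
apply: (@le_trans _ _ ((e * (z - s))%:E + (K%:R * (z - s))%:E)%E).
  rewrite -EFinD lee_fin -mulrDl (le_trans (growth s z sx xz zsd)) //.
  by rewrite ler_wpM2r // addrC lerD2l.
rewrite leeD ?tauK // lee_fin ler_wpM2r // lerDr //.
Qed.

Lemma derive_ae_lipschitz f f' c (N : set R) : 0 <= c ->
  (forall x, is_derive x 1 f (f' x)) -> measurable N -> mu N = 0%E ->
  (forall x, ~ N x -> `|f' x| <= c) ->
  forall x y, `|f x - f y| <= c * `|x - y|.
Proof.
move=> c0 df mN N0 f'c.
have mono x y : x <= y -> `|f x - f y| <= c * (y - x).
  move=> xy; rewrite ler_norml; apply/andP; split.
    rewrite lerNl opprB; apply: (derive_ae_le c0 xy df mN N0) => z /f'c.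
    exact: le_trans (ler_norm _).
  have -> : f x - f y = (- f) y - (- f) x by rewrite !fctE opprK addrC.
  apply: (@derive_ae_le (- f) (fun z => - f' z) c x y N) => //.
  by move=> z /f'c; apply: le_trans; rewrite -normrN ler_norm.
move=> x y; have [xy|/ltW yx] := leP x y.
  by rewrite [`|x - y|]distrC (ger0_norm (_ : 0 <= y - x)) ?subr_ge0 ?mono.
by rewrite distrC (ger0_norm (_ : 0 <= x - y)) ?subr_ge0 ?mono.
Qed.

End Lipschitz.

(** * The nonlinearity is Lipschitz *)

Section GradientBound.
Context {R : realType}.
Implicit Types (c u v x y : R) (N : R -> R) (z : R -> R -> R).
Notation mu := (@lebesgue_measure R).

Lemma near_avoids_null (E : set R) x (P : set R) : measurable E -> mu E = 0%E ->
  (\forall y \near x, P y) -> exists2 y, P y & ~ E y.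
Proof.
move=> mE E0 /nbhs_ballP[d /= d0 dP]; apply/not_exists2P => noy.
have sub : `]x - d, x + d[%classic `<=` E.
  move=> y; rewrite /= in_itv /= => /andP[y1 y2].
  have [Py|//] := noy y; last exact: contrapT.
  by case: Py; apply: dP; rewrite /ball /= ltr_norml; apply/andP; split; lra.
have : (mu `](x - d)%R, (x + d)%R[%classic <= mu E)%E.
  by apply: le_measure; rewrite ?inE.
have xd : x - d < x + d by lra.
rewrite E0 /= lebesgue_measure_itv /= lte_fin xd -EFinB lee_fin => {E0} xd0.
lra.
Qed.

(** By Tonelli almost every vertical line meets the exceptional set of the gradient
    bound in a null set, so [z] is Lipschitz on that line, and by continuity on
    all of them. *)
Lemma Linfty_gradient_lipschitz z c : 0 <= c ->
  (forall u v, u != 0 -> derivable (z u) v 1) -> (forall v, continuous (z ^~ v)) ->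
  (Linfty_gradient z <= c%:E)%E ->
  forall u v v', `|z u v - z u v'| <= c * `|v - v'|.
Proof.
move=> c0 dz cz; rewrite /Linfty_gradient unlock /Lnorm ifT; last first.
  pose I01 : set R := `[0, 1]%classic.
  have m01 : measurable I01 by exact: measurable_itv.
  apply: (@lt_le_trans _ _ ((mu \x mu) (I01 `*` I01))%E).
    rewrite product_measure1E //= /I01 lebesgue_measure_itv /= lte_fin ltr01 sube0.
    by rewrite mule1 lte01.
  by apply: le_measure; rewrite ?inE //; exact: measurableX.
move=> /ess_supP[A [mA A0 badA]].
have gradA u v : ~ A (u, v) -> `|derive1 (z u) v| <= c.
  move=> nA.
  have : ~ ~ ((abse \o (EFin \o gradient_norm z)) (u, v) <= c%:E)%E.
    by move=> H; apply: nA; apply: badA.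
  move=> /contrapT /=; rewrite lee_fin ger0_norm ?sqrtr_ge0 //=.
  apply: le_trans; rewrite /gradient_norm /= -sqrtr_sqr ler_sqrt ?sqr_ge0 //.
    by rewrite lerDr sqr_ge0.
  by rewrite addr_ge0 ?sqr_ge0.
have [E [mE E0 badE]] : {ae mu, forall u, mu (xsection A u) = 0%E}.
  have mA' := measurable_fun_xsection mu mA.
  have : ae_eq mu setT (fun u => mu (xsection A u)) (cst 0%E).
    apply/(ae_eq_integral_abs mu measurableT mA').
    rewrite -[RHS]A0; apply: eq_integral => u _.
    by rewrite gee0_abs //; exact: measure_ge0.
  by apply: filterS => u; apply.
move=> u v v'; rewrite leNgt; apply/negP => bad.
have cdiff : continuous (fun u => `|z u v - z u v'|).
  by move=> y; apply: cvg_norm; apply: cvgB; exact: cz.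
have [] := @near_avoids_null (E `|` [set 0]) u
    [set y | c * `|v - v'| < `|z y v - z y v'|].
- by apply: measurableU => //; exact: measurable_set1.
- apply/eqP; rewrite -measure_le0.
  apply: le_trans (measureU2 mu mE (measurable_set1 0)) _.
  have s0 : mu [set 0] = 0%E by exact: lebesgue_measure_set1.
  by rewrite [X in (X + _ <= _)%E]E0 add0e [leLHS]s0.
- exact: (cvgr_gt _ (cdiff u)).
move=> y /= + /not_orP[nE /eqP y0]; rewrite ltNge => /negP; apply.
have sect0 : mu (xsection A y) = 0%E.
  by apply: contrapT => H; apply: nE; exact: badE.
apply: (@derive_ae_lipschitz _ (z y) (derive1 (z y)) c (xsection A y)) => //.
- by move=> x; rewrite derive1E; apply: DeriveDef => //; exact: dz.
- exact: measurable_xsection.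
- by move=> x nAx; apply: gradA => Ax; apply: nAx; rewrite /xsection /= inE.
Qed.

(** Differentiability at positive radii gives continuity there, and the difference
    quotient at 0 has a limit; evenness makes the latter two-sided. *)
Lemma continuous_even_extension N : admissible_nonlinearity N ->
  continuous (fun r : R => N `|r|).
Proof.
move=> [_ _ dN [d _ N0] _] r; have [->|rN0] := eqVneq r 0.
  suff : N y @[y --> 0^'+] --> N 0.
    move=> H; apply/cvgrPdist_lt => e e0; rewrite normr0.
    have [del /= del0 Hdel] : \forall y \near 0^'+, `|N 0 - N y| < e.
      by move/cvgrPdist_lt : H; exact.
    near=> y; have [->|y0] := eqVneq y 0; first by rewrite normr0 subrr normr0.
    apply: Hdel; last by rewrite normr_gt0.
    rewrite /ball /= sub0r normrN normr_id.
    near: y; apply/nbhs_ballP; exists del => // y.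
    by rewrite /ball /= sub0r normrN.
  have H : r * (r^-1 * (N r - N 0)) + N 0 @[r --> 0^'+] --> 0 * d + N 0.
    apply: cvgD; last exact: cvg_cst.
    apply: cvgM N0; apply: cvg_at_right_filter; exact: cvg_id.
  rewrite mul0r add0r in H; apply: cvg_trans H; apply: near_eq_cvg.
  near=> y; have y0 : 0 < y by near: y; exact: nbhs_right_gt.
  by rewrite mulVKf ?subrK // gt_eqF.
apply: (@continuous_comp _ _ _ (fun r : R => `|r|) N).
  exact: norm_continuous.
apply: differentiable_continuous; apply/derivable1_diffP.
by have [] := dN `|r| _; rewrite ?normr_gt0.
Unshelve. all: by end_near. Qed.

Lemma radial_swap N u v : radial N u v = radial N v u.
Proof. by rewrite /radial addrC. Qed.

Lemma continuous_radial N v : admissible_nonlinearity N ->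
  continuous (fun u => radial N u v).
Proof.
move=> hN.
have -> : (fun u => radial N u v) =
    (fun r : R => N `|r|) \o Num.sqrt \o (fun u => u ^+ 2 + v ^+ 2).
  by apply/funext => u /=; rewrite ger0_norm ?sqrtr_ge0.
move=> u; apply: continuous_comp.
  by apply: cvgD; [exact: exprn_continuous|exact: cvg_cst].
apply: continuous_comp; first exact: sqrt_continuous.
exact: continuous_even_extension.
Qed.

(** Off the axis the radius stays positive, where [N] is differentiable. *)
Lemma derivable_radial N u v : admissible_nonlinearity N -> u != 0 ->
  derivable (radial N u) v 1.
Proof.
move=> [_ _ dN _ _] u0.
have s0 : 0 < u ^+ 2 + v ^+ 2.
  by rewrite ltr_pwDl ?sqr_ge0 // lt_def sqrf_eq0 u0 sqr_ge0.
apply/derivable1_diffP.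
apply: (@differentiable_comp _ _ _ _ (fun v => Num.sqrt (u ^+ 2 + v ^+ 2)) N).
  apply: (@differentiable_comp _ _ _ _ (fun v => u ^+ 2 + v ^+ 2) Num.sqrt).
    apply/derivable1_diffP; apply: derivableD; first exact: derivable_cst.
    exact: exprn_derivable.
  by apply/derivable1_diffP; have [] := is_derive1_sqrt s0.
by apply/derivable1_diffP; have [] := dN (Num.sqrt (u ^+ 2 + v ^+ 2)); rewrite ?sqrtr_gt0.
Qed.

(** Exchanging the variables turns [z1] into [z2], so that the derivatives along one
    variable suffice for both functions. *)
Lemma nonlinearity_lipschitz N c : 0 <= c -> admissible_nonlinearity N ->
  (Linfty_gradient (z1 N) + Linfty_gradient (z2 N) <= c%:E)%E ->
  (forall u v u' v', `|z1 N u v - z1 N u' v'| <= c * (`|u - u'| + `|v - v'|)) /\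
  (forall u v u' v', `|z2 N u v - z2 N u' v'| <= c * (`|u - u'| + `|v - v'|)).
Proof.
move=> c0 hN grad.
have grad0 z : (0 <= Linfty_gradient z)%E by exact: Lnorm_ge0.
have grad1 : (Linfty_gradient (z1 N) <= c%:E)%E by exact: le_trans (leeDl _ _) grad.
have grad2 : (Linfty_gradient (z2 N) <= c%:E)%E by exact: le_trans (leeDr _ _) grad.
have lip1 : forall u v v', `|z1 N u v - z1 N u v'| <= c * `|v - v'|.
  apply: Linfty_gradient_lipschitz grad1 => // [u v u0|v].
    by apply: derivableM; [exact: derivable_radial|exact: derivable_cst].
  by apply: continuous_mul; [exact: continuous_radial|move=> x; exact: cvg_id].
have lip2 : forall u v v', `|z2 N u v - z2 N u v'| <= c * `|v - v'|.
  apply: Linfty_gradient_lipschitz grad2 => // [u v u0|v].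
    by apply: derivableM; [exact: derivable_radial|exact: derivable_id].
  by apply: continuous_mul; [exact: continuous_radial|move=> x; exact: cvg_cst].
have swap u v : z1 N u v = z2 N v u by rewrite /z1 /z2 radial_swap.
split=> u v u' v'.
  rewrite -[z1 N u v](subrK (z1 N u' v)) -addrA (le_trans (ler_normD _ _)) //.
  by rewrite mulrDr lerD // !swap.
rewrite -[z2 N u v](subrK (z2 N u' v)) -addrA (le_trans (ler_normD _ _)) //.
by rewrite mulrDr lerD // -!swap.
Qed.

End GradientBound.

(** * Norms of broken functions *)

Section BrokenIntegral.
Context {R : realType}.
Implicit Types (a b x : R) (f g : R -> R) (X : nat -> R).
Notation mu := (@lebesgue_measure R).

Lemma increasing_nodes X M : (forall j, (j < M)%N -> X j < X j.+1) ->
  forall i j, (i <= j)%N -> (j <= M)%N -> X i <= X j.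
Proof.
move=> Xlt i j; elim: j => [|j IHj]; first by rewrite leqn0 => /eqP->.
rewrite leq_eqVlt => /predU1P[-> //|ij] jM.
by rewrite (le_trans (IHj _ _)) ?ltW ?Xlt // ltnW.
Qed.

Lemma continuous_measurable_on (D : set R) f : continuous f -> measurable_fun D f.
Proof. by move=> cf; exact: (measurable_funTS (continuous_measurable_fun cf)). Qed.

(** The nodes form a null set, so the values of [g] there do not matter, and the
    integral splits over the open cells. *)
Lemma broken_integral X M g (F : nat -> R -> R) :
  (forall j, (j < M)%N -> X j < X j.+1) -> (forall j, continuous (F j)) ->
  (forall x, 0 <= g x) ->
  (forall j x, (j < M)%N -> X j < x < X j.+1 -> g x = F j x) ->
  measurable_fun `[X 0%N, X M] g /\
  (\int[mu]_(x in `[X 0%N, X M]) (g x)%:E =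
   (\sum_(j < M) cell_int (X j) (X j.+1) (F j))%:E)%E.
Proof.
move=> Xlt cF g0; elim: M Xlt => [|M IHM] Xlt gF.
  rewrite set_itv1 big_ord0; split; first exact: measurable_fun_set1.
  by rewrite integral_set1.
have [|j x jM|mg intg] := IHM; [by move=> j jM; apply: Xlt; rewrite ltnW|
  by apply: gF; rewrite ltnW|].
have XM : X M < X M.+1 by exact: Xlt.
have X0M : X 0%N <= X M.
  by apply: (increasing_nodes (M := M.+1)) => //; rewrite ltnW.
have mcell : measurable_fun `]X M, X M.+1[ g.
  apply: (eq_measurable_fun (F M)) => [x|].
    by rewrite inE /= in_itv /= => xM; rewrite (gF M).
  exact: continuous_measurable_on.
have mlast : measurable_fun `]X M, X M.+1] g.
  rewrite -(setUitv1 true) ?bnd_simp //; apply/measurable_funU => //.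
  by split => //; exact: measurable_fun_set1.
have -> : `[X 0%N, X M.+1]%classic = `[X 0%N, X M] `|` `]X M, X M.+1].
  by rewrite (@itv_bndbnd_setU _ _ _ (BRight (X M))) // bnd_simp // ltW.
split; first exact/measurable_funU.
rewrite ge0_integral_setU //=; last 3 first.
- by apply/measurable_EFinP/measurable_funU.
- by move=> x _; rewrite lee_fin.
- apply/disj_setPS => x []; rewrite /= !in_itv /= => /andP[_ xM] /andP[].
  by rewrite ltNge xM.
rewrite [X in (X + _)%E]intg -integral_itv_bndo_bndc; last exact/measurable_EFinP.
rewrite big_ord_recr EFinD; congr (_ + _)%E.
rewrite /cell_int /Rintegral fineK; last first.
  by apply: integrable_fin_num => //; exact: integrable_cell.
apply: eq_integral => x; rewrite inE /= in_itv /= => xM.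
by rewrite (gF M).
Qed.

Lemma L2normE a b f :
  L2norm a b f = ((\int[mu]_(x in `[a, b]) (f x ^+ 2)%:E) `^ 2^-1)%E.
Proof.
rewrite /L2norm unlock; congr (_ `^ _)%E.
rewrite [RHS]integral_mkcond; apply: eq_integral => x _.
rewrite /= !patchE; case: ifPn => _ /=.
  by rewrite powR_mulrn // real_normK ?num_real.
by rewrite normr0 powR0.
Qed.

Lemma L2norm_broken X M f (F : nat -> R -> R) :
  (forall j, (j < M)%N -> X j < X j.+1) -> (forall j, continuous (F j)) ->
  (forall j x, (j < M)%N -> X j < x < X j.+1 -> f x = F j x) ->
  L2norm (X 0%N) (X M) f =
  (Num.sqrt (\sum_(j < M) cell_int (X j) (X j.+1) (fun x => F j x ^+ 2)))%:E.
Proof.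
move=> Xlt cF fF; rewrite L2normE.
have [||||_ ->] := @broken_integral X M (fun x => f x ^+ 2) (fun j x => F j x ^+ 2) => //.
- by move=> j; apply: continuous_mul.
- by move=> x; exact: sqr_ge0.
- by move=> j x jM xj; rewrite (fF j).
rewrite poweR12_sqrt // lee_fin; apply: sumr_ge0 => j _.
by apply: cell_int_ge0 => x _; exact: sqr_ge0.
Qed.

Lemma L2norm_continuous a b f : a < b -> continuous f ->
  L2norm a b f = (Num.sqrt (cell_int a b (fun x => f x ^+ 2)))%:E.
Proof.
move=> ab cf; pose X (j : nat) := if j is 0%N then a else b.
have := @L2norm_broken X 1 f (fun=> f); rewrite big_ord1; apply => //.
by move=> j; rewrite ltnS leqn0 => /eqP->.
Qed.

Lemma in_L2_continuous a b f : a < b -> continuous f -> in_L2 a b f.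
Proof.
move=> ab cf; rewrite /in_L2 inE; apply/andP; split.
  rewrite inE /=; apply/(measurable_restrictT f (measurable_itv `[a, b])).
  exact: continuous_measurable_on.
rewrite inE /= /finite_norm.
by have := L2norm_continuous ab cf; rewrite /L2norm => ->; rewrite ltry.
Qed.

Lemma L2norm_le a b f B : a < b -> continuous f -> 0 <= B ->
  (forall x, a < x < b -> `|f x| <= B) ->
  (L2norm a b f <= (B * Num.sqrt (b - a))%:E)%E.
Proof.
move=> ab cf B0 fB; rewrite L2norm_continuous // lee_fin.
rewrite -[in leRHS](ger0_norm B0) -sqrtr_sqr -sqrtrM ?sqr_ge0 //.
rewrite ler_sqrt; last by rewrite mulr_ge0 ?sqr_ge0 // subr_ge0 ltW.
rewrite -(cell_int_cst (B ^+ 2) (ltW ab)); apply: le_cell_int.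
- by apply: continuous_mul.
- by move=> x; exact: cvg_cst.
by move=> x /fB xB; rewrite -real_normK ?num_real // lerXn2r ?nnegrE.
Qed.

End BrokenIntegral.

(** * Smooth functions as elements of Sobolev spaces *)

Section WeakDerivatives.
Context {R : realType}.
Implicit Types (a b x : R) (phi : R -> R).

Lemma test_function_derive a b phi n :
  test_function a b phi -> continuous (derive1n n phi) /\
  (forall x, (x <= a \/ b <= x) -> derive1n n phi x = 0).
Proof.
move=> [dphi [c [d [ac db phi0]]]]; split.
  by move=> x; apply/differentiable_continuous/derivable1_diffP/dphi.
suff out : forall x, x \notin `[c, d] -> derive1n n phi x = 0.
  move=> x xab; apply: out; rewrite in_itv /= negb_and -!ltNge.
  by case: xab => [xa|bx]; [rewrite (le_lt_trans xa)|rewrite (lt_le_trans db) ?orbT].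
elim: n => [//|n IHn] x xcd; rewrite derive1nS derive1E.
have near0 : \near x, cst 0 x = derive1n n phi x.
  move: xcd; rewrite in_itv /= negb_and -!ltNge => /orP[xc|dx]; near=> y.
    apply/esym/IHn; rewrite in_itv /= negb_and -!ltNge.
    by apply/orP; left; near: y; exact: lt_nbhsl.
  apply/esym/IHn; rewrite in_itv /= negb_and -!ltNge.
  by apply/orP; right; near: y; exact: lt_nbhsr.
by rewrite -(near_eq_derive _ near0) derive_cst.
Unshelve. all: by end_near. Qed.

(** Integration by parts without boundary terms, since all derivatives of a test
    function vanish at the ends. *)
Lemma weak_derivative_smooth a b k (G : nat -> R -> R) : a < b ->
  (forall i, continuous (G i)) ->
  (forall i x, a < x < b -> is_derive x 1 (G i) (G i.+1 x)) ->
  weak_derivative a b k (G 0%N) (G k).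
Proof.
move=> ab cG dG; split; first exact: in_L2_continuous.
move=> phi tphi.
have cphi n := (test_function_derive n tphi).1.
have phi0 n := (test_function_derive n tphi).2.
rewrite !cell_int_segment; [|exact: continuous_mul (cphi 0%N)|exact: continuous_mul].
suff H n i : cell_int a b (fun x => G i x * derive1n n phi x) =
    (-1) ^+ n * cell_int a b (fun x => G (i + n)%N x * phi x) by rewrite H.
elim: n i => [|n IHn] i; first by rewrite expr0 mul1r addn0.
have : cell_int a b (fun x => G i x * derive1n n.+1 phi x + G i.+1 x * derive1n n phi x) = 0.
  transitivity (G i b * derive1n n phi b - G i a * derive1n n phi a); last first.
    by rewrite !phi0 ?mulr0 ?subrr //; [left|right].
  apply: (cell_int_FTC (F := fun x => G i x * derive1n n phi x) ab).
  - exact: continuous_mul.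
  - by apply: continuous_add; exact: continuous_mul.
  - move=> x xab; have dGx := dG i x xab.
    have dphix : is_derive x 1 (derive1n n phi) (derive1n n.+1 phi x).
      by rewrite derive1nS derive1E; apply: DeriveDef => //; case: tphi.
    by have := is_deriveM dGx dphix; rewrite /GRing.scale /= [_ * G i.+1 x]mulrC.
rewrite cell_intD; [|exact: continuous_mul..].
move/eqP; rewrite addr_eq0 IHn => /eqP ->.
by rewrite exprS mulN1r mulNr addSnnS.
Qed.

Lemma in_sobolev_smooth a b m (G : nat -> R -> R) : a < b ->
  (forall i, continuous (G i)) ->
  (forall i x, a < x < b -> is_derive x 1 (G i) (G i.+1 x)) ->
  in_sobolev a b m (G 0%N).
Proof.
move=> ab cG dG; split.
- exact: continuous_subspaceT.
- exact: in_L2_continuous.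
- by move=> k _; exists (G k); exact: weak_derivative_smooth.
Qed.

End WeakDerivatives.

(** * Time derivatives of polynomials and projections *)

Section DerivativesOfSums.
Context {R : realType}.
Implicit Types (t : R).

Lemma is_derive_bigsum (I : Type) (s : seq I) (F : I -> R -> R) (dF : I -> R) t :
  (forall i, is_derive t 1 (F i) (dF i)) ->
  is_derive t 1 (fun t => \sum_(i <- s) F i t) (\sum_(i <- s) dF i).
Proof.
move=> HF; elim: s => [|i s IHs].
  rewrite big_nil (_ : (fun=> _) = cst 0); first exact: is_derive_cst.
  by apply/funext => y; rewrite big_nil.
rewrite big_cons (_ : (fun=> _) = F i + (fun t => \sum_(j <- s) F j t)).
  exact: is_deriveD.
by apply/funext => y; rewrite big_cons.
Qed.

Lemma is_derive_scalel (F : R -> R) (dF c : R) t :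
  is_derive t 1 F dF -> is_derive t 1 (fun t => F t * c) (dF * c).
Proof.
move=> HF; rewrite (_ : (fun t => F t * c) = c \*: F).
  by rewrite mulrC; exact: is_deriveZ.
by apply/funext => y; rewrite /= mulrC.
Qed.

Lemma is_derive_scaler (F : R -> R) (dF c : R) t :
  is_derive t 1 F dF -> is_derive t 1 (fun t => c * F t) (c * dF).
Proof. by move=> HF; exact: is_deriveZ. Qed.

(** Interpolation at fixed points expresses a polynomial of bounded degree by finitely
    many of its values, so differentiating the values differentiates the polynomial. *)
Lemma derive_poly_family n (l r t : R) (w : R -> R -> R) : (0 < n)%N -> l < r ->
  (\forall s \near t, exists2 P : {poly R}, (size P <= n)%N &
     forall x, l < x < r -> w x s = P.[x]) ->
  (forall x, l < x < r -> derivable (w x) t 1) ->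
  exists2 W : {poly R}, (size W <= n)%N &
    forall x, l < x < r -> is_derive t 1 (w x) W.[x].
Proof.
move=> n0 lr wP dw; pose y := sample l r n.
have yI : injective y by exact: sample_inj.
have ylr (i : 'I_n) : l < y i < r by apply: sample_in.
pose L (i : 'I_n) : {poly R} := tnth (qpoly.lagrange n y) i.
exists (\sum_(i < n) derive1 (w (y i)) t *: L i).
  apply: (leq_trans (size_sum _ _ _)); apply/bigmax_leqP => i _.
  by rewrite (leq_trans (size_scale_leq _ _)) // qpoly.size_lagrange_.
move=> x xlr; rewrite horner_sum.
have wE : \near t, \sum_(i < n) w (y i) t * (L i).[x] = w x t.
  near=> s.
  have [P sP PE] : exists2 P : {poly R}, (size P <= n)%N &
    forall x, l < x < r -> w x s = P.[x] by near: s.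
  rewrite PE // [in RHS](qpoly.lagrange_gen n0 yI sP) horner_sum.
  by apply: eq_bigr => i _; rewrite hornerM hornerC PE.
apply: (near_eq_is_derive wE); apply: is_derive_bigsum => i.
rewrite hornerZ; apply: is_derive_scalel; rewrite derive1E.
by apply: DeriveDef => //; exact: dw.
Unshelve. all: by end_near. Qed.

End DerivativesOfSums.

Section ProjectionInTime.
Context {R : realType} (q : nat).
Implicit Types (l r : R) (e : bool).

Let g l r k (y : R) := ((y - l) / (r - l)) ^+ k.

Let g_le1 l r k y : l < r -> l < y < r -> `|g l r k y| <= 1.
Proof.
move=> lr /andP[ly yr].
have h0 : 0 < r - l by rewrite subr_gt0.
have y0 : 0 <= (y - l) / (r - l) by rewrite divr_ge0 ?subr_ge0 // ltW.
rewrite /g ger0_norm ?exprn_ge0 // exprn_ile1 // ler_pdivrMr // mul1r.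
by rewrite lerB // ltW.
Qed.

Let jcont_weight l r k (u : R -> R -> R) : jointly_continuous u ->
  jointly_continuous (fun y t => u y t * g l r k y).
Proof.
move=> cu p; apply: cvgM; first exact: cu.
by apply: (@continuous_comp _ _ _ fst (g l r k)); [exact: cvg_fst|exact: continuous_affX].
Qed.

Lemma radau_fun_time l r e i (c d B : R) (u v : R -> R -> R) t : l < r ->
  jointly_continuous u -> jointly_continuous v ->
  (forall y s, l <= y <= r -> c < s < d -> is_derive s 1 (u y) (v y s)) ->
  (forall y s, `|v y s| <= B) -> c < t < d ->
  is_derive t 1 (fun s => radau_fun l r e i (u ^~ s)) (radau_fun l r e i (v ^~ t)).
Proof.
move=> lr cu cv duv vB tcd; case: i => [|k] /=.
  by apply: duv => //; rewrite /radau_end; case: e; rewrite lexx ltW.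
apply: is_derive_scaler.
apply: (@is_derive_cell_int _ l r c d (fun y s => u y s * g l r k y)
  (fun y s => v y s * g l r k y) B) => //; try exact: jcont_weight.
- by move=> y s /andP[ly yr] scd; apply: is_derive_scalel; apply: duv; rewrite ?ltW.
- by move=> y s ylr; rewrite normrM -[B]mulr1 ler_pM // g_le1.
Qed.

Lemma continuous_radau_fun_time l r e i B (u : R -> R -> R) : l < r ->
  jointly_continuous u -> (forall y s, `|u y s| <= B) ->
  continuous (fun s => radau_fun l r e i (u ^~ s)).
Proof.
move=> lr cu uB; case: i => [|k] /=; first exact: jointly_continuous_right.
apply: continuous_scale.
apply: (@continuous_cell_int _ l r (fun y s => u y s * g l r k y) B).
  exact: jcont_weight.
by move=> y s ylr; rewrite normrM -[B]mulr1 ler_pM // g_le1.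
Qed.

Lemma is_derive_radau_proj l r e (c d B : R) (u v : R -> R -> R) t x : l < r ->
  jointly_continuous u -> jointly_continuous v ->
  (forall y s, l <= y <= r -> c < s < d -> is_derive s 1 (u y) (v y s)) ->
  (forall y s, `|v y s| <= B) -> c < t < d ->
  is_derive t 1 (fun s => (radau_proj q l r e (u ^~ s)).[x])
    (radau_proj q l r e (v ^~ t)).[x].
Proof.
move=> lr cu cv duv vB tcd; rewrite horner_radau_proj.
have -> : (fun s => (radau_proj q l r e (u ^~ s)).[x]) = fun s =>
    \sum_(i < q.+1) radau_fun l r e i (u ^~ s) * (cell_basis l r e i).[x].
  by apply/funext => s; rewrite horner_radau_proj.
apply: is_derive_bigsum => i; apply: is_derive_scalel.
exact: radau_fun_time vB tcd.
Qed.

Lemma continuous_radau_proj l r e B (u : R -> R -> R) x : l < r ->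
  jointly_continuous u -> (forall y s, `|u y s| <= B) ->
  continuous (fun s => (radau_proj q l r e (u ^~ s)).[x]).
Proof.
move=> lr cu uB.
have -> : (fun s => (radau_proj q l r e (u ^~ s)).[x]) = fun s =>
    \sum_(i < q.+1) radau_fun l r e i (u ^~ s) * (cell_basis l r e i).[x].
  by apply/funext => s; rewrite horner_radau_proj.
apply: continuous_sum => i; apply: continuous_mul; last by move=> ?; exact: cvg_cst.
exact: continuous_radau_fun_time uB.
Qed.

End ProjectionInTime.

(** * Broken polynomials and their traces *)

Section MeshFacts.
Context {R : realType}.
Implicit Types (a b x : R) (s : seq R).

Lemma node0 a s : node a s 0 = a. Proof. by []. Qed.

Lemma node_last a b s : itv_partition a b s -> node a s (size s) = b.
Proof. exact: itv_partition_nth_size. Qed.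

Lemma node_lt a b s j : itv_partition a b s -> (j < size s)%N ->
  node a s j < node a s j.+1.
Proof.
by move=> [/(pathP a) H _] js; exact: H.
Qed.

Lemma node_ge a b s j : itv_partition a b s -> (j <= size s)%N -> a <= node a s j.
Proof.
move=> ps js; rewrite -[leLHS](node0 a s).
by apply: (increasing_nodes (M := size s)) => // i; exact: node_lt ps.
Qed.

Lemma node_le a b s j : itv_partition a b s -> (j <= size s)%N -> node a s j <= b.
Proof.
move=> ps js; rewrite -[leRHS](node_last ps).
by apply: (increasing_nodes (M := size s)) => // i; exact: node_lt ps.
Qed.

Lemma size_partition_gt0 a b s : a < b -> itv_partition a b s -> (0 < size s)%N.
Proof.
by case: s => // ab /itv_partition_nil abE; rewrite abE ltxx in ab.
Qed.

Lemma cell_size_le_mesh a s j : (j < size s)%N -> cell_size a s j <= mesh_size a s.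
Proof.
move=> js; rewrite /mesh_size.
exact: (@le_bigmax _ _ _ 0 (fun j : 'I_(size s) => cell_size a s j) (Ordinal js)).
Qed.

Lemma sum_cell_size a b s : itv_partition a b s ->
  \sum_(j < size s) (node a s j.+1 - node a s j) = b - a.
Proof.
move=> ps; rewrite -(big_mkord xpredT (fun j => node a s j.+1 - node a s j)).
by rewrite telescope_sumr // (node_last ps) node0.
Qed.

Lemma cellE a s j x : cell a s j x <-> node a s j < x < node a s j.+1.
Proof. by rewrite /cell /= in_itv. Qed.

End MeshFacts.

Section BrokenPolynomials.
Context {R : realType} (q : nat).
Implicit Types (a b x : R) (s : seq R) (v : R -> R) (P : nat -> {poly R}).

Definition piecewise a s v P := forall j x, (j < size s)%N ->
  node a s j < x < node a s j.+1 -> v x = (P j).[x].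

Lemma broken_polyP a s v : broken_poly q a s v ->
  exists2 P : nat -> {poly R},
    (forall j, (size (P j) <= q.+1)%N) & piecewise a s v P.
Proof.
move=> bv.
have /choice[P HP] : forall j, exists P : {poly R}, (size P <= q.+1)%N /\
    ((j < size s)%N -> forall x, node a s j < x < node a s j.+1 -> v x = P.[x]).
  move=> j; have [js|js] := boolP (j < size s)%N; last first.
    by exists 0; split; rewrite ?size_poly0.
  have [P sP PE] := bv j js; exists P; split => // _ x xj.
  by apply: PE; rewrite inE; apply/cellE.
exists P => [j|j x js xj]; first by case: (HP j).
by have [_] := HP j; apply.
Qed.

Lemma piecewise_broken a s v P : (forall j, (j < size s)%N -> (size (P j) <= q.+1)%N) ->
  piecewise a s v P -> broken_poly q a s v.
Proof.
move=> sP vP j js; exists (P j); first exact: sP.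
by move=> x; rewrite inE => /cellE; exact: vP.
Qed.

(** Test functions of the scheme are global; the discrete error is known cell by cell. *)
Definition glue_poly a s P x : R :=
  \sum_(j < size s) (if node a s j < x < node a s j.+1 then (P j).[x] else 0).

Lemma glue_poly_piecewise a b s P : itv_partition a b s -> piecewise a s (glue_poly a s P) P.
Proof.
move=> ps j x js /andP[jx xj].
have mono := increasing_nodes (fun i (is_ : (i < size s)%N) => node_lt ps is_).
rewrite /glue_poly (bigD1 (Ordinal js)) //= jx xj big1 ?addr0 // => i ij.
case: ifP => // /andP[ix xi]; exfalso.
have : (i < j)%N || (j < i)%N by rewrite -neq_ltn; apply: contraNneq ij => E; apply/eqP/val_inj.
case/orP => lt_ij.
- have := mono i.+1 j lt_ij (ltnW js).
  by move/(lt_le_trans xi)/lt_trans/(_ jx); rewrite ltxx.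
- have := mono j.+1 i lt_ij (ltnW (ltn_ord i)).
  by move/(lt_le_trans xj)/lt_trans/(_ ix); rewrite ltxx.
Qed.

Lemma right_lim_poly v (p : {poly R}) l r : l < r ->
  (forall x, l < x < r -> v x = p.[x]) -> right_lim v l = p.[l].
Proof.
move=> lr vp; apply: cvg_lim => //.
have : horner p @ l^'+ --> p.[l] by apply/cvg_at_right_filter/continuous_horner.
apply: cvg_trans; apply: near_eq_cvg; near=> x.
apply/esym/vp/andP; split; first by near: x; exact: nbhs_right_gt.
by near: x; exact: nbhs_right_lt.
Unshelve. all: by end_near. Qed.

Lemma left_lim_poly v (p : {poly R}) l r : l < r ->
  (forall x, l < x < r -> v x = p.[x]) -> left_lim v r = p.[r].
Proof.
move=> lr vp; apply: cvg_lim => //.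
have : horner p @ r^'- --> p.[r] by apply/cvg_at_left_filter/continuous_horner.
apply: cvg_trans; apply: near_eq_cvg; near=> x.
apply/esym/vp/andP; split; last by near: x; exact: nbhs_left_lt.
by near: x; exact: nbhs_left_gt.
Unshelve. all: by end_near. Qed.

Lemma derive1_poly_on v (p : {poly R}) l r x : (forall x, l < x < r -> v x = p.[x]) ->
  l < x < r -> derive1 v x = p^`().[x].
Proof.
move=> vp /andP[lx xr]; rewrite derivE !derive1E; apply: near_eq_derive.
near=> y; apply: vp; apply/andP; split.
  by near: y; exact: lt_nbhsr.
by near: y; exact: lt_nbhsl.
Unshelve. all: by end_near. Qed.

End BrokenPolynomials.

Section Quadrature.
Context {R : realType} (q : nat).

(** Exactness on squares extends to products by polarization. *)
Lemma quadrature_polar (l r : R) n (x om : nat -> R) (P Q : {poly R}) :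
  (forall P : {poly R}, (size P <= q.+1)%N ->
     \sum_(k < n) om k * P.[x k] ^+ 2 = cell_int l r (fun y => P.[y] ^+ 2)) ->
  (size P <= q.+1)%N -> (size Q <= q.+1)%N ->
  \sum_(k < n) om k * (P.[x k] * Q.[x k]) = cell_int l r (fun y => P.[y] * Q.[y]).
Proof.
move=> exact2 sP sQ.
have polar (u v : R) : u * v = ((u + v) ^+ 2 - u ^+ 2 - v ^+ 2) * 2^-1 by field.
have sPQ : (size (P + Q)%R <= q.+1)%N.
  by rewrite (leq_trans (size_polyD _ _)) // geq_max sP.
have csq (S : {poly R}) : continuous (fun y => S.[y] ^+ 2).
  by apply: continuous_mul; exact: continuous_horner.
have -> : (fun y => P.[y] * Q.[y]) =
    (fun y => 2^-1 * ((P + Q).[y] ^+ 2 - P.[y] ^+ 2 - Q.[y] ^+ 2)).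
  by apply/funext => y; rewrite polar hornerD mulrC.
rewrite cell_intZ; last exact/continuous_sub/csq/continuous_sub.
rewrite cell_intB; [|exact: continuous_sub|exact: csq].
rewrite cell_intB // -!exact2 // -!sumrB mulr_sumr.
by apply: eq_bigr => k _; rewrite polar hornerD; ring.
Qed.

End Quadrature.

(** * The energy inequality on a cell *)

Section CellEnergy.
Context {R : realType} (q : nat).
Implicit Types (l r : R) (e : bool) (W Wt : {poly R}).

(** The orthogonality of the projection to lower degrees removes the volume
    term of the projection error, and the interpolated end removes its flux. What is left
    of the fluxes is bounded by a difference that telescopes: this is the dissipation
    of the upwind choice. *)
Lemma cell_energy l r e W Wt (u ut ux : R -> R) (wl wr S : R) :
  l < r -> continuous u -> continuous ut -> continuous ux ->
  (forall x, l < x < r -> is_derive x 1 u (ux x)) ->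
  (size W <= q.+1)%N ->
  let sg : R := (-1) ^+ e in
  let p := radau_proj q l r e u in
  let pt := radau_proj q l r e ut in
  let xi := p - W in
  cell_int l r (fun x => Wt.[x] * xi.[x] + sg * (W.[x] * xi^`().[x])) + sg * S
    = sg * (wr * xi.[r] - wl * xi.[l]) ->
  (if e then u r - wr = xi.[r] else u l - wl = xi.[l]) ->
  cell_int l r (fun x => (pt - Wt).[x] * xi.[x]) <=
  cell_int l r (fun x => (pt.[x] - ut x) * xi.[x])
  - sg * (cell_int l r (fun x => (ux x - sg * ut x) * xi.[x]) - S)
  + sg * ((u r - wr) ^+ 2 - (u l - wl) ^+ 2) / 2.
Proof.
move=> lr cu cut cux du sW sg p pt xi scheme trace.
have sg2 : sg * sg = 1 by rewrite /sg; case: (e); rewrite ?expr0 ?expr1 ?mulrNN mulr1.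
have ch (P : {poly R}) : continuous (fun x => P.[x]) by exact: continuous_horner.
have sxi : (size xi <= q.+1)%N.
  rewrite (leq_trans (size_polyD _ _)) // size_polyN geq_max sW andbT.
  exact: size_radau_proj.
have sdxi : (size xi^`() <= q)%N.
  have [->|xi0] := eqVneq xi 0; first by rewrite deriv0 size_poly0.
  by rewrite -ltnS (leq_trans (lt_size_deriv xi0)).
have orth : cell_int l r (fun x => p.[x] * xi^`().[x]) =
            cell_int l r (fun x => u x * xi^`().[x]).
  have := radau_proj_orth e lr cu sdxi.
  under eq_cell_int => x _ do rewrite mulrBl.
  rewrite cell_intB; [|exact: continuous_mul..].
  by move/eqP; rewrite subr_eq0 => /eqP.
have parts : cell_int l r (fun x => u x * xi^`().[x]) =
    u r * xi.[r] - u l * xi.[l] - cell_int l r (fun x => ux x * xi.[x]).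
  apply/eqP; rewrite eq_sym subr_eq eq_sym -cell_intD; [|exact: continuous_mul..].
  apply/eqP; apply: (cell_int_FTC (F := fun x => u x * xi.[x]) lr).
  - exact: continuous_mul.
  - by apply: continuous_add; exact: continuous_mul.
  - move=> x xlr; have dux := du x xlr; have dxi := is_derive_horner xi x.
    by have := is_deriveM dux dxi; rewrite /GRing.scale /= [_ * ux x]mulrC.
have square : cell_int l r (fun x => xi.[x] * xi^`().[x]) =
    (xi.[r] ^+ 2 - xi.[l] ^+ 2) / 2.
  have : cell_int l r (fun x => xi.[x] * xi^`().[x] + xi.[x] * xi^`().[x]) =
      xi.[r] * xi.[r] - xi.[l] * xi.[l].
    apply: (cell_int_FTC (F := fun x => xi.[x] * xi.[x]) lr).
    - exact: continuous_mul.
    - by apply: continuous_add; exact: continuous_mul.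

  rewrite cell_intD; [|exact: continuous_mul|exact: continuous_mul].
  rewrite !expr2; lra.
have Wdxi : cell_int l r (fun x => W.[x] * xi^`().[x]) =
    cell_int l r (fun x => p.[x] * xi^`().[x]) -
    cell_int l r (fun x => xi.[x] * xi^`().[x]).
  rewrite -cell_intB; [|exact: continuous_mul..]; apply: eq_cell_int => x _.
  by rewrite hornerD hornerN; ring.
have ptE : cell_int l r (fun x => (pt - Wt).[x] * xi.[x]) =
    cell_int l r (fun x => (pt.[x] - ut x) * xi.[x]) +
    cell_int l r (fun x => ut x * xi.[x]) - cell_int l r (fun x => Wt.[x] * xi.[x]).
  rewrite -cell_intD; [|exact/continuous_mul/ch/continuous_sub|exact: continuous_mul].
  rewrite -cell_intB; last exact: continuous_mul; last first.
    exact/continuous_add/continuous_mul/ch/cut/continuous_mul/ch/continuous_sub.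
  by apply: eq_cell_int => x _; rewrite hornerD hornerN; ring.
have fE : cell_int l r (fun x => (ux x - sg * ut x) * xi.[x]) =
    cell_int l r (fun x => ux x * xi.[x]) - sg * cell_int l r (fun x => ut x * xi.[x]).
  rewrite -cell_intZ; last exact: continuous_mul.
  rewrite -cell_intB; [|exact: continuous_mul|exact/continuous_scale/continuous_mul].
  by apply: eq_cell_int => x _; ring.
move: scheme; rewrite cell_intD; [|exact: continuous_mul|exact/continuous_scale/continuous_mul].
rewrite cell_intZ; last exact: continuous_mul.
rewrite ptE fE Wdxi orth parts square.
set I1 := cell_int l r (fun x => (pt.[x] - ut x) * xi.[x]).
set I2 := cell_int l r (fun x => ut x * xi.[x]).
set I3 := cell_int l r (fun x => Wt.[x] * xi.[x]).
set I4 := cell_int l r (fun x => ux x * xi.[x]).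
clearbody I1 I2 I3 I4; move: trace; rewrite /sg.
move: (xi.[r]) (xi.[l]) (u r) (u l) => xr xl ur ul.
(* The dissipated quantity is the square of the jump at the other end of the cell. *)
case: (e); rewrite ?expr0 ?expr1 => tr sch.
  have wrE : wr = ur - xr by lra.
  have := sqr_ge0 (ul - wl - xl); move: sch; rewrite wrE; nra.
have wlE : wl = ul - xl by lra.
have := sqr_ge0 (ur - wr - xr); move: sch; rewrite wlE; nra.
Qed.

End CellEnergy.

(** * The error estimate for one field *)

Section UpwindScheme.
Context {R : realType} (q : nat) (a T : R) (e : bool) (s : seq R).
Context (K : nat -> nat) (xq om : nat -> nat -> R).

Definition upwind_trace (v : R -> R) j : R :=
  if e then trace_minus a s v j else trace_plus a s v j.

(** The two equations of the scheme differ by a sign only, once the values [zh] of the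
    nonlinear term are considered as data. *)
Definition upwind_scheme (wh zh : R -> R -> R) : Prop :=
  forall t phi j, 0 < t < T -> broken_poly q a s phi -> (j < size s)%N ->
  cell_int (node a s j) (node a s j.+1)
    (fun x => derive1 (wh x) t * phi x + (-1) ^+ e * (wh x t * derive1 phi x)) +
  (-1) ^+ e * (\sum_(k < K j) om j k * zh (xq j k) t * phi (xq j k)) =
  (-1) ^+ e * (upwind_trace (wh ^~ t) j.+1 * left_lim phi (node a s j.+1)
        - upwind_trace (wh ^~ t) j * right_lim phi (node a s j)).

End UpwindScheme.

Section OneField.
Context {R : realType} (q : nat) (a b T : R) (e : bool) (s : seq R).
Context (K : nat -> nat) (xq om : nat -> nat -> R).
Context (D : nat -> nat -> R -> R -> R) (wh zh : R -> R -> R).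
Hypotheses (ab : a < b) (ps : itv_partition a b s) (sD : smooth_family a b T D).

Let sg : R := (-1) ^+ e.
Let M := size s.
Let X := node a s.

Definition mesh_proj (u : R -> R -> R) j t : {poly R} :=
  radau_proj q (node a s j) (node a s j.+1) e (u ^~ t).

Lemma cell_in j x : (j < M)%N -> X j <= x <= X j.+1 -> a <= x <= b.
Proof.
move=> js /andP[jx xj]; rewrite (le_trans (node_ge ps (ltnW js))) //=.
exact: le_trans (node_le ps js).
Qed.

Lemma cell_in_oo j x : (j < M)%N -> X j < x < X j.+1 -> a < x < b.
Proof.
move=> js /andP[jx xj]; rewrite (le_lt_trans (node_ge ps (ltnW js))) //=.
exact: lt_le_trans (node_le ps js).
Qed.

Let cD i j t : continuous (D i j ^~ t).
Proof. by apply: jointly_continuous_left; case: sD. Qed.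

Lemma mesh_proj_error B i j t x : (j < M)%N -> 0 <= t <= T ->
  (forall x t, `|D q.+1 i x t| <= B) -> X j <= x <= X j.+1 ->
  `|(mesh_proj (D 0%N i) j t).[x] - D 0%N i x t|
    <= (radau_cst q e + 1) * (B * mesh_size a s ^+ q.+1).
Proof.
move=> js tT DB xj; have [_ _ dx _] := sD.
have B0 : 0 <= B by exact: le_trans (DB 0 0).
have h0 : 0 <= X j.+1 - X j by rewrite subr_ge0 ltW // (node_lt ps).
apply: le_trans (@radau_proj_error _ q (X j) (X j.+1) e (fun k => D k i ^~ t) B
  _ _ _ _ x xj) _ => //.
- exact: node_lt ps js.
- by move=> k y /(cell_in_oo js) yab; exact: dx.
rewrite ler_wpM2l ?addr_ge0 ?radau_cst_ge0 // ler_wpM2l //.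
have hm := cell_size_le_mesh a js.
by rewrite lerXn2r ?nnegrE // (le_trans h0).
Qed.

Lemma is_derive_mesh_proj j t x : (j < M)%N -> 0 < t < T ->
  is_derive t 1 (fun t => (mesh_proj (D 0%N 0%N) j t).[x])
    (mesh_proj (D 0%N 1%N) j t).[x].
Proof.
move=> js tT; have [cjD bD _ dt] := sD; have [B DB] := bD 0%N 1%N.
apply: (@is_derive_radau_proj _ q (X j) (X j.+1) e 0 T B) => //.
  exact: node_lt ps js.
by move=> y u yj uT; apply: dt => //; exact: cell_in yj.
Qed.

Lemma continuous_mesh_proj j x : (j < M)%N ->
  continuous (fun t => (mesh_proj (D 0%N 0%N) j t).[x]).
Proof.
move=> js; have [cjD bD _ _] := sD; have [B DB] := bD 0%N 0%N.
by apply: continuous_radau_proj DB => //; exact: node_lt ps js.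
Qed.

Hypothesis broken_wh : forall t, 0 <= t <= T -> broken_poly q a s (wh ^~ t).
Hypothesis derivable_wh : forall j x t, (j < M)%N -> X j < x < X j.+1 -> 0 < t < T ->
  derivable (wh x) t 1.
Hypothesis periodic : forall t, 0 <= t <= T -> D 0%N 0%N a t = D 0%N 0%N b t.
Hypothesis scheme : upwind_scheme q a T e s K xq om wh zh.
Hypothesis quad_in : forall j k, (j < M)%N -> (k < K j)%N -> X j < xq j k < X j.+1.
Hypothesis quad_exact : forall j (P : {poly R}), (j < M)%N -> (size P <= q.+1)%N ->
  \sum_(k < K j) om j k * P.[xq j k] ^+ 2 = cell_int (X j) (X j.+1) (fun x => P.[x] ^+ 2).

(** The index [e + j] is that of the end of cell [j] at which the projection
    interpolates. *)
Lemma upwind_trace_piecewise v P j : piecewise a s v P -> (j < M)%N ->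
  upwind_trace a e s v (e + j) = (P j).[if e then X j.+1 else X j].
Proof.
move=> vP js; rewrite /upwind_trace; case: (e); rewrite ?add1n ?add0n.
  rewrite /trace_minus /=; apply: left_lim_poly (node_lt ps js) _ => x xj.
  exact: vP.
rewrite /trace_plus ltn_eqF //; apply: right_lim_poly (node_lt ps js) _ => x xj.
exact: vP.
Qed.

Lemma upwind_trace_periodic v : upwind_trace a e s v 0 = upwind_trace a e s v M.
Proof.
have M0 : (0 < M)%N := size_partition_gt0 ab ps.
rewrite /upwind_trace /trace_minus /trace_plus /= -/M eqxx.
by rewrite !(gtn_eqF M0) ltn_eqF // ; case: (e).
Qed.

(** The error equation: testing the scheme with the discrete error and adding the cells,
    the upwind fluxes telescope around the period. *)
Lemma field_energy t : 0 < t < T -> exists xi dxi : nat -> {poly R},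
  [/\ forall j, (size (xi j) <= q.+1)%N,
      forall j x, (j < M)%N -> X j < x < X j.+1 ->
        (mesh_proj (D 0%N 0%N) j t).[x] - wh x t = (xi j).[x],
      forall j x, (j < M)%N -> X j < x < X j.+1 ->
        is_derive t 1 (fun t => (mesh_proj (D 0%N 0%N) j t).[x] - wh x t) (dxi j).[x] &
      \sum_(j < M) \sum_(k < K j) om j k * ((dxi j).[xq j k] * (xi j).[xq j k]) <=
      \sum_(j < M) cell_int (X j) (X j.+1)
         (fun x => ((mesh_proj (D 0%N 1%N) j t).[x] - D 0%N 1%N x t) * (xi j).[x])
      - sg * \sum_(j < M) (cell_int (X j) (X j.+1)
           (fun x => (D 1%N 0%N x t - sg * D 0%N 1%N x t) * (xi j).[x])
         - \sum_(k < K j) om j k * zh (xq j k) t * (xi j).[xq j k])].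
Proof.
move=> tT; have [t0 tT'] := andP tT.
have tT0 : 0 <= t <= T by rewrite !ltW.
have [P sP whP] := broken_polyP (broken_wh tT0).
have /choice[Pt HPt] : forall j, exists Q : {poly R}, (size Q <= q.+1)%N /\
    ((j < M)%N -> forall x, X j < x < X j.+1 -> is_derive t 1 (wh x) Q.[x]).
  move=> j; have [js|js] := boolP (j < M)%N; last first.
    by exists 0; split; rewrite ?size_poly0.
  have near_poly : \forall u \near t, exists2 Q : {poly R}, (size Q <= q.+1)%N &
      forall x, X j < x < X j.+1 -> wh x u = Q.[x].
    near=> u; have uT : 0 <= u <= T.
      apply/andP; split; first by apply/ltW; near: u; exact: lt_nbhsr.
      by apply/ltW; near: u; exact: lt_nbhsl.
    have [Pu sPu uP] := broken_polyP (broken_wh uT).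
    by exists (Pu j) => // x xj; exact: uP.
  have dj x : X j < x < X j.+1 -> derivable (wh x) t 1.
    by move=> xj; exact: derivable_wh js xj tT.
  have [Q sQ QE] := derive_poly_family (ltn0Sn q) (node_lt ps js) near_poly dj.
  by exists Q.
have sPt j := (HPt j).1.
have whPt j := (HPt j).2.
pose p j := mesh_proj (D 0%N 0%N) j t.
pose pt j := mesh_proj (D 0%N 1%N) j t.
pose xi j := p j - P j.
have sxi j : (size (xi j) <= q.+1)%N.
  by rewrite (leq_trans (size_polyD _ _)) // size_polyN geq_max sP size_radau_proj.
pose phi := glue_poly a s xi.
have phiE : piecewise a s phi xi by exact: glue_poly_piecewise ps.
have bphi : broken_poly q a s phi by apply: piecewise_broken phiE => j _; exact: sxi.
pose gam j := D 0%N 0%N (X j) t - upwind_trace a e s (wh ^~ t) j.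
have gamE j : (j < M)%N -> gam (e + j)%N = (xi j).[if e then X j.+1 else X j].
  move=> js; rewrite /gam (upwind_trace_piecewise whP js) /xi hornerD hornerN.
  congr (_ - _); have := @radau_proj_end _ q (X j) (X j.+1) e (D 0%N 0%N ^~ t) (node_lt ps js).
  by rewrite /radau_end /p /mesh_proj /X; case: (e); rewrite ?add1n ?add0n => ->.
have gamM : gam M = gam 0%N.
  by rewrite /gam -upwind_trace_periodic {1}/X (node_last ps) /X node0 periodic.
have cell j : (j < M)%N ->
    \sum_(k < K j) om j k * ((pt j - Pt j).[xq j k] * (xi j).[xq j k]) <=
    cell_int (X j) (X j.+1) (fun x => ((pt j).[x] - D 0%N 1%N x t) * (xi j).[x])
    - sg * (cell_int (X j) (X j.+1)
           (fun x => (D 1%N 0%N x t - sg * D 0%N 1%N x t) * (xi j).[x])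
         - \sum_(k < K j) om j k * zh (xq j k) t * (xi j).[xq j k])
    + sg * (gam j.+1 ^+ 2 - gam j ^+ 2) / 2.
  move=> js; have jlt := node_lt ps js.
  rewrite (quadrature_polar (l := X j) (r := X j.+1) (q := q)) //; last 2 first.
  - by move=> Q sQ; exact: quad_exact.
  - by rewrite (leq_trans (size_polyD _ _)) // size_polyN geq_max sPt size_radau_proj.
  apply: (@cell_energy R q (X j) (X j.+1) e (P j) (Pt j) (D 0%N 0%N ^~ t)
    (D 0%N 1%N ^~ t) (D 1%N 0%N ^~ t)) => //.
  - move=> x xj; have [_ _ dx _] := sD; apply: dx => //; exact: cell_in_oo js xj.
  - have := scheme tT bphi js.
    have -> : left_lim phi (X j.+1) = (xi j).[X j.+1].
      by apply: left_lim_poly jlt _ => x xj; exact: phiE.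
    have -> : right_lim phi (X j) = (xi j).[X j].
      by apply: right_lim_poly jlt _ => x xj; exact: phiE.
    move=> <-; congr (_ + sg * _).
      apply: eq_cell_int => x xj; rewrite (phiE j) // (whP j x js xj).
      rewrite (derive1_poly_on (v := phi) (p := xi j) (l := X j) (r := X j.+1)) //; last first.
        by move=> y yj; exact: phiE.
      have dw := whPt j js x xj.
      by rewrite derive1E (_ : 'D_1 (wh x) t = (Pt j).[x]) //; exact: derive_val.
    by apply: eq_bigr => k _; rewrite (phiE j) //; exact: quad_in.
  - move: (gamE j js); rewrite /gam /xi /p /mesh_proj -/X.
    by case: (e); rewrite /= ?add1n ?add0n.
exists xi, (fun j => pt j - Pt j); split => //.
- by move=> j x js xj; rewrite /xi hornerD hornerN (whP j x js xj).
- move=> j x js xj; rewrite hornerD hornerN.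
  have d1 := is_derive_mesh_proj x js tT; have d2 := whPt j js x xj.
  exact: is_deriveB.
apply: le_trans (ler_sum _ (fun (j : 'I_M) _ => cell j (ltn_ord j))) _.
(* The flux errors agree at the two ends of the period. *)
have tele : \sum_(j < M) sg * (gam j.+1 ^+ 2 - gam j ^+ 2) / 2 = 0.
  rewrite -mulr_suml -mulr_sumr -(big_mkord xpredT (fun j => gam j.+1 ^+ 2 - gam j ^+ 2)).
  by rewrite telescope_sumr // gamM subrr mulr0 mul0r.
by rewrite big_split /= tele addr0 sumrB mulr_sumr.
Unshelve. all: by end_near. Qed.

(** Only the values at the quadrature points are needed: they determine the norm of the
    discrete error, and they are where the nonlinear term is evaluated. *)
Definition disc_err j k t : R := (mesh_proj (D 0%N 0%N) j t).[xq j k] - wh (xq j k) t.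

(** Young's inequality throughout: the projection error and the quadrature error are of
    order [h ^ (q + 1)], and the remaining terms are quadratic in the discrete error. The
    nonlinear term enters only through the distance of its values [zh] to the smooth
    function [u_x - sg u_t], to which it is equal along the solution. *)
Lemma field_estimate t (B C0 F : R) (Z : nat -> nat -> R) : 0 < t < T ->
  (forall x t, `|D q.+1 1%N x t| <= B) ->
  (forall x t, `|D q.+2 0%N x t| + `|D q.+1 1%N x t| <= F) ->
  (forall phi f g, broken_poly q a s phi ->
     in_sobolev a b q.+1 f -> weak_derivative a b q.+1 f g ->
     ((\sum_(j < size s)
        `| \sum_(k < K j) om j k * (phi (xq j k) * f (xq j k))
           - cell_int (X j) (X j.+1) (fun x => phi x * f x) |)%:E
      <= (C0 * mesh_size a s ^+ q.+1)%:E * L2norm a b phi * L2norm a b g)%E) ->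
  (forall j k, (j < M)%N -> (k < K j)%N -> 0 <= om j k) ->
  (forall j k, (j < M)%N -> (k < K j)%N ->
     `|D 1%N 0%N (xq j k) t - sg * D 0%N 1%N (xq j k) t - zh (xq j k) t| <= Z j k) ->
  let H := mesh_size a s ^+ q.+1 in
  let n2 := \sum_(j < M) \sum_(k < K j) om j k * disc_err j k t ^+ 2 in
  exists2 d : nat -> nat -> R,
    forall j k, (j < M)%N -> (k < K j)%N -> is_derive t 1 (disc_err j k) (d j k) &
    \sum_(j < M) \sum_(k < K j) om j k * (d j k * disc_err j k t) <=
    ((radau_cst q e + 1) * (B * H)) ^+ 2 * (b - a) / 2 + n2 / 2
    + ((`|C0| * H * (F * Num.sqrt (b - a))) ^+ 2 / 2 + n2 / 2)
    + \sum_(j < M) \sum_(k < K j) om j k * (Z j k * `|disc_err j k t|).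
Proof.
move=> tT DB DF quad om0 fZ H n2; have tT0 : 0 <= t <= T.
  by case/andP: tT => t0 tT'; rewrite !ltW.
have [cjD _ dx _] := sD.
have [xi [dxi [sxi xiE dxiE energy]]] := field_energy tT.
have errE j k : (j < M)%N -> (k < K j)%N -> disc_err j k t = (xi j).[xq j k].
  by move=> js kK; rewrite -xiE //; exact: quad_in.
exists (fun j k => (dxi j).[xq j k]).
  by move=> j k js kK; apply: dxiE => //; exact: quad_in.
have n2E : n2 = \sum_(j < M) cell_int (X j) (X j.+1) (fun x => (xi j).[x] ^+ 2).
  apply: eq_bigr => j _; rewrite -quad_exact //.
  by apply: eq_bigr => k _; rewrite errE.
have n20 : 0 <= n2.
  by rewrite n2E; apply: sumr_ge0 => j _; apply: cell_int_ge0 => x _; exact: sqr_ge0.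
set eps := (radau_cst q e + 1) * (B * H).
pose f x := D 1%N 0%N x t - sg * D 0%N 1%N x t.
have cf : continuous f by apply: continuous_sub => //; exact: continuous_scale.
rewrite (eq_bigr (fun j : 'I_M => \sum_(k < K j)
    om j k * ((dxi j).[xq j k] * (xi j).[xq j k]))); last first.
  by move=> j _; apply: eq_bigr => k _; rewrite errE.
apply: (le_trans energy).
have term1 : \sum_(j < M) cell_int (X j) (X j.+1)
    (fun x => ((mesh_proj (D 0%N 1%N) j t).[x] - D 0%N 1%N x t) * (xi j).[x])
    <= eps ^+ 2 * (b - a) / 2 + n2 / 2.
  rewrite n2E -(sum_cell_size ps) -/M mulr_sumr !mulr_suml -big_split /=.
  apply: ler_sum => j _; have jlt := node_lt ps (ltn_ord j).
  have csq : continuous (fun x => 2^-1 * (xi j).[x] ^+ 2).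
    by apply: continuous_scale; apply: continuous_mul; exact: continuous_horner.
  have ceps : continuous (fun _ : R => eps ^+ 2 / 2) by move=> ?; exact: cvg_cst.
  have -> : eps ^+ 2 * (node a s j.+1 - node a s j) / 2
      + cell_int (X j) (X j.+1) (fun x => (xi j).[x] ^+ 2) / 2 =
    cell_int (X j) (X j.+1) (fun x => eps ^+ 2 / 2 + 2^-1 * (xi j).[x] ^+ 2).
    rewrite cell_intD // cell_int_cst ?ltW // cell_intZ; last first.
      by apply: continuous_mul; exact: continuous_horner.
    by rewrite /X; ring.
  apply: le_cell_int; last 1 first.
  - move=> x /andP[jx xj].
    have xj' : X j <= x <= X j.+1 by rewrite !ltW.
    have := @mesh_proj_error B 1 j t x (ltn_ord j) tT0 DB xj'; rewrite -/eps.
    set et := _ - D 0%N 1%N x t; move: (xi j).[x] => y et_le.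
    have et2 : et ^+ 2 <= eps ^+ 2.
      by rewrite -real_normK ?num_real // lerXn2r ?nnegrE // (le_trans _ et_le).
    have := sqr_ge0 (et - y); nra.
  - apply: continuous_mul; last exact: continuous_horner.
    by apply: continuous_sub => //; exact: continuous_horner.
  - exact: continuous_add.
have term2 : \sum_(j < M) `| \sum_(k < K j) om j k * ((xi j).[xq j k] * f (xq j k))
      - cell_int (X j) (X j.+1) (fun x => (xi j).[x] * f x) |
    <= (`|C0| * H * (F * Num.sqrt (b - a))) ^+ 2 / 2 + n2 / 2.
  pose phi := glue_poly a s xi.
  have phiE : piecewise a s phi xi by exact: glue_poly_piecewise ps.
  have bphi : broken_poly q a s phi by apply: piecewise_broken phiE => j _; exact: sxi.
  pose G i x := D i.+1 0%N x t - sg * D i 1%N x t.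
  have cG i : continuous (G i) by apply: continuous_sub => //; exact: continuous_scale.
  have dG i x : a < x < b -> is_derive x 1 (G i) (G i.+1 x).
    move=> xab; have d1 := dx i.+1 0%N x t xab tT0.
    have d2 := is_derive_scaler sg (dx i 1%N x t xab tT0).
    exact: is_deriveB.
  have := quad phi f (G q.+1) bphi (in_sobolev_smooth _ ab cG dG)
    (weak_derivative_smooth _ ab cG dG).
  have -> : L2norm a b phi = (Num.sqrt n2)%:E.
    have := @L2norm_broken R X M phi (fun j => horner (xi j)).
    rewrite /X (node_last ps) node0 n2E; apply.
    - by move=> j; exact: node_lt ps.
    - by move=> j; exact: continuous_horner.
    - by move=> j x js xj; exact: phiE.
  have F0 : 0 <= F by apply: le_trans (DF 0 0); rewrite addr_ge0.
  have /(_ ab (cG q.+1) F0) := @L2norm_le R a b (G q.+1) F.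
  have GF x : a < x < b -> `|G q.+1 x| <= F.
    move=> _; apply: le_trans (DF x t); rewrite /G (le_trans (ler_normB _ _)) //.
    by rewrite lerD2l normrM normrX normrN1 expr1n mul1r.
  move=> /(_ GF); have g0 : (0 <= L2norm a b (G q.+1))%E by exact: Lnorm_ge0.
  move: g0; case: (L2norm a b (G q.+1)) => [g g0 gF|_|//]; last by rewrite leye_eq.
  rewrite -!EFinM lee_fin => quad_le.
  rewrite lee_fin in g0; rewrite lee_fin in gF.
  have H0 : 0 <= H.
    by rewrite exprn_ge0 // /mesh_size; elim/big_rec: _ => // i x _ x0; rewrite le_max x0 orbT.
  set Y := F * _ in gF *.
  apply: (@le_trans _ _ ((`|C0| * H * Y) * Num.sqrt n2)); last first.
    have := sqr_ge0 (`|C0| * H * Y - Num.sqrt n2).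
    have := sqr_sqrtr n20; move: (Num.sqrt n2) (`|C0| * H * Y) => z A zz.
    rewrite -[X in _ -> _ <= _ + X / 2]zz; nra.
  rewrite (eq_bigr (fun j : 'I_M => `| \sum_(k < K j) om j k * (phi (xq j k) * f (xq j k))
      - cell_int (X j) (X j.+1) (fun x => phi x * f x) |)); last first.
    move=> j _; congr (`| _ - _ |).
      by apply: eq_bigr => k _; rewrite (phiE j) //; exact: quad_in.
    by apply: eq_cell_int => x xj; rewrite (phiE j).
  apply: (le_trans quad_le); rewrite -!mulrA -/H.
  apply: (@le_trans _ _ (`|C0| * (H * (Num.sqrt n2 * g)))).
    by rewrite ler_wpM2r ?ler_norm // !mulr_ge0 // sqrtr_ge0.
  by rewrite ler_wpM2l // ler_wpM2l // mulrC (mulrA F) ler_wpM2r ?sqrtr_ge0.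
have term3 : \sum_(j < M) `| \sum_(k < K j)
      om j k * ((f (xq j k) - zh (xq j k) t) * (xi j).[xq j k]) |
    <= \sum_(j < M) \sum_(k < K j) om j k * (Z j k * `|disc_err j k t|).
  apply: ler_sum => j _; apply: (le_trans (ler_norm_sum _ _ _)).
  apply: ler_sum => k _; rewrite !normrM (ger0_norm (om0 _ _ _ _)) //.
  by rewrite ler_wpM2l ?om0 // errE // ler_wpM2r // fZ.
have sgn x : - (sg * x) <= `|x|.
  by rewrite (le_trans (ler_norm _)) // normrN normrM normrX normrN1 expr1n mul1r.
have term23 : - (sg * \sum_(j < M) (cell_int (X j) (X j.+1) (fun x => f x * (xi j).[x])
         - \sum_(k < K j) om j k * zh (xq j k) t * (xi j).[xq j k])) <=
    \sum_(j < M) `| \sum_(k < K j) om j k * ((xi j).[xq j k] * f (xq j k))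
      - cell_int (X j) (X j.+1) (fun x => (xi j).[x] * f x) | +
    \sum_(j < M) `| \sum_(k < K j)
      om j k * ((f (xq j k) - zh (xq j k) t) * (xi j).[xq j k]) |.
  apply: (le_trans (sgn _)); rewrite -big_split /=.
  apply: (le_trans (ler_norm_sum _ _ _)); apply: ler_sum => j _.
  have -> : \sum_(k < K j) om j k * zh (xq j k) t * (xi j).[xq j k] =
    \sum_(k < K j) om j k * ((xi j).[xq j k] * f (xq j k)) -
    \sum_(k < K j) om j k * ((f (xq j k) - zh (xq j k) t) * (xi j).[xq j k]).
    by rewrite -sumrB; apply: eq_bigr => k _; ring.
  have -> : cell_int (X j) (X j.+1) (fun x => f x * (xi j).[x]) =
      cell_int (X j) (X j.+1) (fun x => (xi j).[x] * f x).
    by apply: eq_cell_int => x _; rewrite mulrC.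
  by rewrite distrC addrAC ler_normB.
rewrite -[leRHS]addrA; apply: lerD => //.
exact: (le_trans term23 (lerD term2 term3)).
Qed.

Lemma quad_weights_sum : \sum_(j < M) \sum_(k < K j) om j k = b - a.
Proof.
rewrite -(sum_cell_size ps); apply: eq_bigr => j _.
have := @quad_exact j 1 (ltn_ord j); rewrite size_poly1 => /(_ isT).
under eq_bigr => k _ do rewrite hornerC expr1n mulr1.
move=> ->; under eq_cell_int => x _ do rewrite hornerC expr1n.
by rewrite cell_int_cst ?mul1r // ltW // (node_lt ps).
Qed.

Lemma disc_err_initial (w : R -> R -> R) j k : (j < M)%N -> (k < K j)%N -> 0 <= T ->
  (forall x, a <= x <= b -> D 0%N 0%N x 0 = w x 0) ->
  radau_orthogonal q a s (w ^~ 0) (wh ^~ 0) ->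
  (forall j, (j < M)%N -> if e then left_lim (wh ^~ 0) (X j.+1) = w (X j.+1) 0
                          else right_lim (wh ^~ 0) (X j) = w (X j) 0) ->
  disc_err j k 0 = 0.
Proof.
move=> js kK T0 wE orth ends; have jlt := node_lt ps js.
have T00 : 0 <= (0 : R) <= T by rewrite lexx.
have [P sP whP] := broken_polyP (broken_wh T00).
have -> : disc_err j k 0 = (mesh_proj (D 0%N 0%N) j 0).[xq j k] - (P j).[xq j k].
  by rewrite -whP //; exact: quad_in.
suff -> : P j = mesh_proj (D 0%N 0%N) j 0 by rewrite subrr.
apply: radau_proj_unique => //.
  have Xl : a <= X j <= b by apply: (cell_in js); rewrite lexx ltW.
  have Xr : a <= X j.+1 <= b by apply: (cell_in js); rewrite lexx ltW.
  move: (ends j js); rewrite /radau_end; case: (e); rewrite wE // => <-; apply/esym.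
    by apply: left_lim_poly jlt _ => x xj; exact: whP.
  by apply: right_lim_poly jlt _ => x xj; exact: whP.
move=> V sV; rewrite -[RHS](orth j V js sV); apply: eq_cell_int => x xj.
rewrite (whP j x js xj) wE //.
by case/andP: (cell_in_oo js xj) => ax xb; rewrite !ltW.
Qed.

Lemma continuous_disc_err j k : (j < M)%N -> {within `[0, T], continuous (wh (xq j k))} ->
  {within `[0, T], continuous (disc_err j k)}.
Proof.
move=> js cwh x; apply: cvgB; last exact: cwh.
by have := continuous_subspaceT (@continuous_mesh_proj j (xq j k) js); apply.
Qed.

Lemma L2norm_error_le (w : R -> R) B t : 0 <= t <= T ->
  (forall x, a <= x <= b -> D 0%N 0%N x t = w x) ->
  (forall x t, `|D q.+1 0%N x t| <= B) ->
  (L2norm a b (fun x => (w x - wh x t)%R) <=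
   (Num.sqrt (2 * (\sum_(j < M) \sum_(k < K j) om j k * disc_err j k t ^+ 2)
     + 2 * ((radau_cst q e + 1) * (B * mesh_size a s ^+ q.+1)) ^+ 2 * (b - a)))%:E)%E.
Proof.
move=> tT wE DB; set eps := (radau_cst q e + 1) * _; have [P sP whP] := broken_polyP (broken_wh tT).
pose F j x := D 0%N 0%N x t - (P j).[x].
have cF j : continuous (F j) by apply: continuous_sub => //; exact: continuous_horner.
have -> : L2norm a b (fun x => w x - wh x t) =
    (Num.sqrt (\sum_(j < M) cell_int (X j) (X j.+1) (fun x => F j x ^+ 2)))%:E.
  have := @L2norm_broken R X M (fun x => w x - wh x t) F.
  rewrite /X (node_last ps) node0; apply => // [j js|j x js xj].
    exact: node_lt ps js.
  rewrite /F (whP j x js xj) wE //.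
  by case/andP: (cell_in_oo js xj) => ax xb; rewrite !ltW.
rewrite lee_fin; apply: ler_wsqrtr.
rewrite -(sum_cell_size ps) !mulr_sumr -big_split /=; apply: ler_sum => j _.
have jlt := node_lt ps (ltn_ord j).
pose xi := mesh_proj (D 0%N 0%N) j t - P j.
have sxi : (size xi <= q.+1)%N.
  by rewrite (leq_trans (size_polyD _ _)) // size_polyN geq_max sP size_radau_proj.
have -> : \sum_(k < K j) om j k * disc_err j k t ^+ 2 =
    cell_int (X j) (X j.+1) (fun x => xi.[x] ^+ 2).
  rewrite -quad_exact //; apply: eq_bigr => k _; congr (_ * _ ^+ 2).
  by rewrite /disc_err /xi hornerD hornerN -whP //; exact: quad_in.
have csq : continuous (fun x => 2 * xi.[x] ^+ 2).
  by apply: continuous_scale; apply: continuous_mul; exact: continuous_horner.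
have ceps : continuous (fun _ : R => 2 * eps ^+ 2) by move=> ?; exact: cvg_cst.
have -> : 2 * cell_int (X j) (X j.+1) (fun x => xi.[x] ^+ 2) +
    2 * eps ^+ 2 * (node a s j.+1 - node a s j) =
  cell_int (X j) (X j.+1) (fun x => 2 * xi.[x] ^+ 2 + 2 * eps ^+ 2).
  rewrite cell_intD // cell_int_cst ?ltW // cell_intZ //.
  by apply: continuous_mul; exact: continuous_horner.
apply: le_cell_int; [exact: continuous_mul|exact: continuous_add|].
move=> x /andP[jx xj]; have xj' : X j <= x <= X j.+1 by rewrite !ltW.
have := @mesh_proj_error B 0 j t x (ltn_ord j) tT DB xj'; rewrite -/eps.
set y := mesh_proj _ _ _; set z := D 0%N 0%N x t => yz.
have -> : F j x = xi.[x] - (y.[x] - z) by rewrite /F /xi hornerD hornerN -/y -/z; ring.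
have yz2 : (y.[x] - z) ^+ 2 <= eps ^+ 2.
  by rewrite -real_normK ?num_real // lerXn2r ?nnegrE // (le_trans _ yz).
have := sqr_ge0 (xi.[x] + (y.[x] - z)); nra.
Qed.

End OneField.

(** * Gronwall's inequality *)

Section Gronwall.
Context {R : realType}.

(** The function exp (- A t) E t - B t is nonincreasing. *)
Lemma gronwall (E : R -> R) (A B T : R) : 0 <= A -> 0 <= B -> 0 <= T ->
  {within `[0, T], continuous E} ->
  (forall t, 0 < t < T -> exists2 dE, is_derive t 1 E dE & dE <= A * E t + B) ->
  E 0 = 0 -> E T <= expR (A * T) * (B * T).
Proof.
move=> A0 B0 T0 cE dE E0.
pose F t := expR (- A * t) * E t - B * t.
have dexp (t : R) : is_derive t 1 (fun t => expR (- A * t)) (- A * expR (- A * t)).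
  have dl : is_derive t 1 (fun t : R => - A * t) (- A).
    by have := is_derive_scaler (- A) (is_derive_id (t : R) (1 : R)); rewrite mulr1.
  by rewrite mulrC; exact: (is_derive1_comp (is_derive_expR _) dl).
have dF t : 0 < t < T -> exists2 dF, is_derive t 1 F dF & dF <= 0.
  move=> tT; have [d dEt dle] := dE t tT; have [t0 _] := andP tT.
  exists (expR (- A * t) * d + E t * (- A * expR (- A * t)) - B * 1).
    by apply: is_deriveB; exact: is_deriveM (dexp t) dEt.
  have ex1 : expR (- A * t) <= 1 by rewrite -expR0 ler_expR mulNr oppr_le0 mulr_ge0 // ltW.
  have ex0 := expR_ge0 (- A * t).
  rewrite mulr1 subr_le0; apply: (@le_trans _ _ (expR (- A * t) * (d - A * E t))).
    by rewrite le_eqVlt; apply/orP; left; apply/eqP; ring.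
  apply: (@le_trans _ _ (expR (- A * t) * B)); first by rewrite ler_wpM2l // lerBlDl.
  by rewrite -[leRHS]mul1r ler_wpM2r.
have cF : {within `[0, T], continuous F}.
  have cexp : {within `[0, T], continuous (fun t => expR (- A * t))}.
    apply: continuous_subspaceT => t; apply: (@continuous_comp _ _ _ (fun t : R => - A * t) expR).
      by apply: cvgM; [exact: cvg_cst|exact: cvg_id].
    exact: continuous_expR.
  have clin : {within `[0, T], continuous (fun t : R => B * t)}.
    by apply: continuous_subspaceT => t; apply: cvgM; [exact: cvg_cst|exact: cvg_id].
  by move=> t; apply: cvgB; [apply: cvgM; [exact: cexp|exact: cE]|exact: clin].
have FT : F T <= F 0.
  have dF1 t : t \in `]0, T[ -> derivable F t 1.
    by rewrite in_itv /= => /dF[d [H _] _].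
  have dF2 t : t \in `]0, T[ -> derive1 F t <= 0.
    by rewrite in_itv /= => /dF[d dFt]; rewrite derive1E derive_val.
  by apply: (ler0_derive1_le_cc dF1 dF2 cF) => //; rewrite in_itv /= ?lexx ?T0.
move: FT; rewrite /F !mulr0 E0 mulr0 subr0 subr_le0 => FT.
have -> : A * T = - (- A * T) by rewrite mulNr opprK.
rewrite expRN -ler_pdivrMl ?invr_gt0 ?expR_gt0 // invrK //.
Qed.

End Gronwall.

(** * The scheme and the equation for each field *)

Section Reduction.
Context {R : realType} (q : nat) (a b T : R) (s : seq R).
Context (K : nat -> nat) (xq om : nat -> nat -> R) (N : R -> R).
Implicit Types (w wh : R -> R -> R) (D : nat -> nat -> R -> R -> R).

Lemma dg_left_scheme w1h w2h : dg_solution q T a s K xq om N w1h w2h ->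
  upwind_scheme q a T false s K xq om w1h (fun x t => z2 N (w1h x t) (w2h x t)).
Proof.
move=> [_ _ _ scheme _] t phi j tT bphi js.
have := scheme t phi j; rewrite in_itv /= => /(_ tT bphi js).
rewrite /upwind_trace expr0 !mul1r => <-; congr (_ + _).
  by apply: eq_cell_int => x _; rewrite mul1r.
by apply: eq_bigr => k _; rewrite /z2 !mulrA.
Qed.

Lemma dg_right_scheme w1h w2h : dg_solution q T a s K xq om N w1h w2h ->
  upwind_scheme q a T true s K xq om w2h (fun x t => z1 N (w1h x t) (w2h x t)).
Proof.
move=> [_ _ _ _ scheme] t phi j tT bphi js.
have := scheme t phi j; rewrite in_itv /= => /(_ tT bphi js).
rewrite /upwind_trace expr1 !mulN1r opprB => <-; congr (_ - _).
  by apply: eq_cell_int => x _; rewrite mulN1r.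
by apply: eq_bigr => k _; rewrite /z1 !mulrA.
Qed.

Lemma smooth_family_derive w D x t : smooth_family a b T D ->
  (forall x t, a <= x <= b -> 0 <= t <= T -> D 0%N 0%N x t = w x t) ->
  a < x < b -> 0 < t < T ->
  derive1 (w x) t = D 0%N 1%N x t /\ derive1 (w ^~ t) x = D 1%N 0%N x t.
Proof.
move=> [_ _ dx dt] Dw /andP[ax xb] /andP[t0 tT]; split; rewrite derive1E.
  have near_eq : \near t, D 0%N 0%N x t = w x t.
    near=> y; apply: Dw; first by rewrite !ltW.
    apply/andP; split; apply: ltW; near: y; [exact: lt_nbhsr|exact: lt_nbhsl].
  rewrite -(near_eq_derive _ near_eq).
  have H : is_derive t 1 (D 0%N 0%N x) (D 0%N 1%N x t) by apply: dt; rewrite ?t0 ?ltW.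
  exact: derive_val.
have near_eq : \near x, D 0%N 0%N x t = w x t.
  near=> y; apply: Dw; last by rewrite !ltW.
  apply/andP; split; apply: ltW; near: y; [exact: lt_nbhsr|exact: lt_nbhsl].
rewrite -(near_eq_derive _ near_eq).
have H : is_derive x 1 (D 0%N 0%N ^~ t) (D 1%N 0%N x t) by apply: dx; rewrite ?ax ?ltW.
exact: derive_val.
Unshelve. all: by end_near. Qed.

Lemma smooth_family_bound D : smooth_family a b T D ->
  exists2 B, 0 <= B & forall i j x t, (i <= q.+2)%N -> (j <= 1)%N -> `|D i j x t| <= B.
Proof.
move=> [_ bD _ _].
have /choice[f Hf] : forall p : nat * nat, exists B, forall x t, `|D p.1 p.2 x t| <= B.
  by case=> i j; exact: bD.
have f0 p : 0 <= f p by exact: le_trans (Hf p 0 0).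
exists (\sum_(i < q.+3) \sum_(j < 2) f (i : nat, j : nat)).
  by apply: sumr_ge0 => i _; apply: sumr_ge0.
move=> i j x t iq j1; apply: le_trans (Hf (i, j) x t) _.
rewrite (bigD1 (Ordinal (iq : (i < q.+3)%N))) //= (bigD1 (Ordinal (j1 : (j < 2)%N))) //=.
rewrite -addrA lerDl addr_ge0 ?sumr_ge0 // => k _; exact: sumr_ge0.
Qed.

End Reduction.

(** * The coupled system *)

Section TwoFields.
Context {R : realType}.

Lemma young_product (x y eps c : R) : 0 <= c -> 0 <= eps ->
  c * (`|x| + `|y| + 2 * eps) * `|x| <= c * (4 * (x ^+ 2 + y ^+ 2) + eps ^+ 2).
Proof.
move=> c0 e0; rewrite -mulrA ler_wpM2l //.
rewrite -[x ^+ 2]real_normK ?num_real // -[y ^+ 2]real_normK ?num_real //.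
move: `|x| `|y| (normr_ge0 x) (normr_ge0 y) => u v u0 v0.
have := sqr_ge0 (u - v); have := sqr_ge0 (u - eps); nra.
Qed.

Lemma weighted_sum_le M (K : nat -> nat) (om e f : nat -> nat -> R) (Z : nat -> nat -> R)
    (c eps L : R) :
  0 <= c -> 0 <= eps ->
  (forall j k, (j < M)%N -> (k < K j)%N -> 0 <= om j k) ->
  \sum_(j < M) \sum_(k < K j) om j k = L ->
  (forall j k, Z j k = c * (`|e j k| + `|f j k| + 2 * eps)) ->
  \sum_(j < M) \sum_(k < K j) om j k * (Z j k * `|e j k|) <=
  c * (4 * (\sum_(j < M) \sum_(k < K j) om j k * e j k ^+ 2
          + \sum_(j < M) \sum_(k < K j) om j k * f j k ^+ 2) + eps ^+ 2 * L).
Proof.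
move=> c0 e0 om0 <- ZE.
rewrite -big_split /= mulr_sumr [X in _ * (_ + X)]mulr_sumr -big_split /= mulr_sumr.
apply: ler_sum => j _.
rewrite -big_split /= mulr_sumr [X in _ * (_ + X)]mulr_sumr -big_split /= mulr_sumr.
apply: ler_sum => k _; rewrite ZE.
have -> : c * (4 * (om j k * e j k ^+ 2 + om j k * f j k ^+ 2) + eps ^+ 2 * om j k) =
  om j k * (c * (4 * (e j k ^+ 2 + f j k ^+ 2) + eps ^+ 2)) by ring.
by rewrite ler_wpM2l ?om0 // young_product.
Qed.

Lemma is_derive_weighted_sqr M (K : nat -> nat) (om : nat -> nat -> R)
    (e : nat -> nat -> R -> R) (d : nat -> nat -> R) (t : R) :
  (forall j k, (j < M)%N -> (k < K j)%N -> is_derive t 1 (e j k) (d j k)) ->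
  is_derive t 1 (fun t => \sum_(j < M) \sum_(k < K j) om j k * e j k t ^+ 2)
    (2 * \sum_(j < M) \sum_(k < K j) om j k * (d j k * e j k t)).
Proof.
move=> de; rewrite mulr_sumr; apply: is_derive_bigsum => j.
rewrite mulr_sumr; apply: is_derive_bigsum => k.
have -> : 2 * (om j k * (d j k * e j k t)) = om j k * (2 * (d j k * e j k t)) by ring.
apply: is_derive_scaler; have dejk := de j k (ltn_ord j) (ltn_ord k).
have := is_deriveM dejk dejk; rewrite /GRing.scale /= => H.
by have -> : 2 * (d j k * e j k t) = e j k t * d j k + e j k t * d j k by ring.
Qed.

Lemma continuous_weighted_sqr M (K : nat -> nat) (om : nat -> nat -> R)
    (e : nat -> nat -> R -> R) (A : set R) :
  (forall j k, (j < M)%N -> (k < K j)%N -> {within A, continuous (e j k)}) ->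
  {within A, continuous (fun t => \sum_(j < M) \sum_(k < K j) om j k * e j k t ^+ 2)}.
Proof.
move=> ce.
have csum (I : finType) (F : I -> R -> R) : (forall i, {within A, continuous (F i)}) ->
    {within A, continuous (fun t => \sum_i F i t)}.
  move=> cF; elim: (index_enum I) => [|i r IHr].
    under eq_fun do rewrite big_nil; exact/continuous_subspaceT/cst_continuous.
  under eq_fun do rewrite big_cons.
  by move=> t; apply: cvgD; [exact: cF|exact: IHr].
apply: (csum _ (fun (j : 'I_M) t => \sum_(k < K j) om j k * e j k t ^+ 2)) => j.
apply: (csum _ (fun (k : 'I_(K j)) t => om j k * e j k t ^+ 2)) => k t.
apply: cvgM; first exact: cvg_cst.
by apply: cvgM; exact: ce.
Qed.

End TwoFields.

Theorem theorem3 (R : realType) (xa xb T : R) (q : nat) (C0 C1 zeta : R)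
    (w1 w2 : R -> R -> R) :
  xa < xb -> 0 < T -> 0 < C1 -> 0 < zeta ->
  smooth_on xa xb T w1 -> smooth_on xa xb T w2 ->
  periodic_bc xa xb T w1 -> periodic_bc xa xb T w2 ->
  exists2 C : R, 0 < C &
    forall N : R -> R,
      admissible_nonlinearity N ->
      solves_pde xa xb T N w1 w2 ->
      (Linfty_gradient (z1 N) + Linfty_gradient (z2 N) <= C1%:E)%E ->
    forall s : seq R,
      itv_partition xa xb s ->
      mesh_size xa s / min_cell_size xa s < zeta ->
    forall (K : nat -> nat) (xq om : nat -> nat -> R),
      admissible_quadrature q C0 xa xb s K xq om ->
    forall w1h w2h : R -> R -> R,
      dg_solution q T xa s K xq om N w1h w2h ->
      radau_plus q xa s (w1 ^~ 0) (w1h ^~ 0) ->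
      radau_minus q xa s (w2 ^~ 0) (w2h ^~ 0) ->
      (L2norm xa xb (fun x => (w1 x T - w1h x T)%R)
       + L2norm xa xb (fun x => (w2 x T - w2h x T)%R)
       <= (C * mesh_size xa s ^+ q.+1)%:E)%E.
Proof.
move=> ab T0 C10 _ sm1 sm2 per1 per2.
have [D1 sD1 D1E] := smooth_on_family ab T0 sm1.
have [D2 sD2 D2E] := smooth_on_family ab T0 sm2.
have [B1 B10 B1E] := smooth_family_bound q sD1.
have [B2 B20 B2E] := smooth_family_bound q sD2.
pose B : R := B1 + B2.
(* KK B h ^ (q + 1) = k1 h ^ (q + 1) bounds both projection errors, k2 h ^ (q + 1) the
   quadrature error; A and Bc are obtained by doubling and adding the estimates
   of the two fields. *)
pose KK : R := radau_cst q false + radau_cst q true + 1.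
pose k1 := KK * B.
pose k2 := `|C0| * (2 * B * Num.sqrt (xb - xa)).
pose A := 2 + 16 * C1.
pose Bc := (2 + 4 * C1) * (k1 ^+ 2 * (xb - xa)) + 2 * k2 ^+ 2.
pose c2 := 2 * (expR (A * T) * (Bc * T)) + 2 * (k1 ^+ 2 * (xb - xa)).
have L0 : 0 <= xb - xa by rewrite subr_ge0 ltW.
have B0 : 0 <= B by rewrite addr_ge0.
have A0 : 0 <= A by rewrite addr_ge0 // mulr_ge0 // ltW.
have C1p := ltW C10.
have L1 : 0 <= k1 ^+ 2 * (xb - xa) by rewrite mulr_ge0 // sqr_ge0.
have Bc0 : 0 <= Bc.
  have c4 : 0 <= 2 + 4 * C1 by lra.
  apply: addr_ge0; first exact: mulr_ge0.
  by apply: mulr_ge0 => //; exact: sqr_ge0.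
have r0 := radau_cst_ge0 (R := R) q false; have r1 := radau_cst_ge0 (R := R) q true.
have KKf : radau_cst q false + 1 <= KK by rewrite /KK; lra.
have KKt : radau_cst q true + 1 <= KK by rewrite /KK; lra.
have KK0 : 0 <= KK by rewrite /KK; lra.
exists (2 * Num.sqrt c2 + 1); first by rewrite ltr_wpDl // mulr_ge0 // sqrtr_ge0.
move=> N hN pde grad s ps _ K xq om [qpts qex qcons] w1h w2h dg rad1 rad2.
have [lip1 lip2] := nonlinearity_lipschitz (ltW C10) hN grad.
have sch1 := dg_left_scheme dg; have sch2 := dg_right_scheme dg.
have [br ct dr _ _] := dg.
have qin j k : (j < size s)%N -> (k < K j)%N ->
    node xa s j < xq j k < node xa s j.+1.
  by move=> js kK; apply/cellE; case: (qpts j k js kK).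
have om0 j k : (j < size s)%N -> (k < K j)%N -> 0 <= om j k.
  by move=> js kK; apply: ltW; case: (qpts j k js kK).
have br1 t : 0 <= t <= T -> broken_poly q xa s (w1h ^~ t).
  by move=> tT; have [] := br t; rewrite ?in_itv.
have br2 t : 0 <= t <= T -> broken_poly q xa s (w2h ^~ t).
  by move=> tT; have [] := br t; rewrite ?in_itv.
have dr1 j x t : (j < size s)%N -> node xa s j < x < node xa s j.+1 -> 0 < t < T ->
    derivable (w1h x) t 1.
  by move=> js /cellE xj tT; have [] := dr j x t js; rewrite ?inE ?in_itv.
have dr2 j x t : (j < size s)%N -> node xa s j < x < node xa s j.+1 -> 0 < t < T ->
    derivable (w2h x) t 1.
  by move=> js /cellE xj tT; have [] := dr j x t js; rewrite ?inE ?in_itv.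
have ends x : x = xa \/ x = xb -> xa <= x <= xb by case=> ->; rewrite lexx ltW.
have per1' t : 0 <= t <= T -> D1 0%N 0%N xa t = D1 0%N 0%N xb t.
  by move=> tT; rewrite !D1E ?per1 ?in_itv //; apply: ends; [right|left].
have per2' t : 0 <= t <= T -> D2 0%N 0%N xa t = D2 0%N 0%N xb t.
  by move=> tT; rewrite !D2E ?per2 ?in_itv //; apply: ends; [right|left].
set H := mesh_size xa s ^+ q.+1.
have H0 : 0 <= H.
  by rewrite exprn_ge0 // /mesh_size; elim/big_rec: _ => // i x _ x0; rewrite le_max x0 orbT.
pose e1 := disc_err q xa false s xq D1 w1h.
pose e2 := disc_err q xa true s xq D2 w2h.
pose eps := KK * (B * H).
have eps0 : 0 <= eps by rewrite !mulr_ge0.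
have T0' := ltW T0.
have B1B x t i j : (i <= q.+2)%N -> (j <= 1)%N -> `|D1 i j x t| <= B.
  by move=> iq j1; rewrite (le_trans (B1E i j x t iq j1)) // lerDl.
have B2B x t i j : (i <= q.+2)%N -> (j <= 1)%N -> `|D2 i j x t| <= B.
  by move=> iq j1; rewrite (le_trans (B2E i j x t iq j1)) // lerDr.
have epsf : (radau_cst q false + 1) * (B * H) <= eps by rewrite ler_wpM2r ?mulr_ge0.
have epst : (radau_cst q true + 1) * (B * H) <= eps by rewrite ler_wpM2r ?mulr_ge0.
have tri (x y z : R) : `|z - x| <= eps -> `|x - y| <= `|z - y| + eps.
  move=> zx; rewrite (_ : x - y = (z - y) - (z - x)); last ring.
  by rewrite (le_trans (ler_normB _ _)) // lerD2l.
have err1 j k t : (j < size s)%N -> (k < K j)%N -> 0 <= t <= T ->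
    `|w1 (xq j k) t - w1h (xq j k) t| <= `|e1 j k t| + eps.
  move=> js kK tT; have xj := qin j k js kK; have [xl xr] := andP xj.
  have xj' : node xa s j <= xq j k <= node xa s j.+1 by rewrite !ltW.
  rewrite -D1E //; last by exact: (cell_in ps js xj').
  apply: tri; apply: le_trans epsf.
  by apply: (mesh_proj_error false ps sD1 js tT _ xj') => x u; exact: B1B.
have err2 j k t : (j < size s)%N -> (k < K j)%N -> 0 <= t <= T ->
    `|w2 (xq j k) t - w2h (xq j k) t| <= `|e2 j k t| + eps.
  move=> js kK tT; have xj := qin j k js kK; have [xl xr] := andP xj.
  have xj' : node xa s j <= xq j k <= node xa s j.+1 by rewrite !ltW.
  rewrite -D2E //; last by exact: (cell_in ps js xj').
  apply: tri; apply: le_trans epst.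
  by apply: (mesh_proj_error true ps sD2 js tT _ xj') => x u; exact: B2B.
have lipZ (z : R -> R -> R) j k t : (j < size s)%N -> (k < K j)%N -> 0 <= t <= T ->
    (forall u v u' v', `|z u v - z u' v'| <= C1 * (`|u - u'| + `|v - v'|)) ->
    `|z (w1 (xq j k) t) (w2 (xq j k) t) - z (w1h (xq j k) t) (w2h (xq j k) t)|
      <= C1 * (`|e1 j k t| + `|e2 j k t| + 2 * eps).
  move=> js kK tT lip; rewrite (le_trans (lip _ _ _ _)) // ler_wpM2l //.
  have := err1 j k t js kK tT; have := err2 j k t js kK tT; lra.
have fZ1 t j k : 0 < t < T -> (j < size s)%N -> (k < K j)%N ->
    `|D1 1%N 0%N (xq j k) t - (-1) ^+ false * D1 0%N 1%N (xq j k) t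
      - z2 N (w1h (xq j k) t) (w2h (xq j k) t)|
    <= C1 * (`|e1 j k t| + `|e2 j k t| + 2 * eps).
  move=> tT js kK; have xab := cell_in_oo ps js (qin j k js kK).
  have [dt dx] := smooth_family_derive sD1 D1E xab tT.
  have pde1 : derive1 (w1 (xq j k)) t = derive1 (w1 ^~ t) (xq j k)
      - z2 N (w1 (xq j k) t) (w2 (xq j k) t).
    by have [] := pde (xq j k) t; rewrite ?in_itv.
  have -> : D1 1%N 0%N (xq j k) t - (-1) ^+ false * D1 0%N 1%N (xq j k) t =
      z2 N (w1 (xq j k) t) (w2 (xq j k) t).
    by rewrite -dt -dx pde1 expr0; ring.
  by apply: lipZ => //; case/andP: tT => t0 tT'; rewrite !ltW.
have fZ2 t j k : 0 < t < T -> (j < size s)%N -> (k < K j)%N ->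
    `|D2 1%N 0%N (xq j k) t - (-1) ^+ true * D2 0%N 1%N (xq j k) t
      - z1 N (w1h (xq j k) t) (w2h (xq j k) t)|
    <= C1 * (`|e2 j k t| + `|e1 j k t| + 2 * eps).
  move=> tT js kK; have xab := cell_in_oo ps js (qin j k js kK).
  have [dt dx] := smooth_family_derive sD2 D2E xab tT.
  have pde2 : derive1 (w2 (xq j k)) t = - derive1 (w2 ^~ t) (xq j k)
      + z1 N (w1 (xq j k) t) (w2 (xq j k) t).
    by have [] := pde (xq j k) t; rewrite ?in_itv.
  have -> : D2 1%N 0%N (xq j k) t - (-1) ^+ true * D2 0%N 1%N (xq j k) t =
      z1 N (w1 (xq j k) t) (w2 (xq j k) t).
    by rewrite -dt -dx pde2 expr1; ring.
  rewrite [`|e2 j k t| + _]addrC.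
  by apply: lipZ => //; case/andP: tT => t0 tT'; rewrite !ltW.
(* By exactness on squares these are the squared norms of the discrete errors. *)
pose n1 t := \sum_(j < size s) \sum_(k < K j) om j k * e1 j k t ^+ 2.
pose n2 t := \sum_(j < size s) \sum_(k < K j) om j k * e2 j k t ^+ 2.
have n10 t : 0 <= n1 t.
  by apply: sumr_ge0 => j _; apply: sumr_ge0 => k _; rewrite mulr_ge0 ?om0 ?sqr_ge0.
have n20 t : 0 <= n2 t.
  by apply: sumr_ge0 => j _; apply: sumr_ge0 => k _; rewrite mulr_ge0 ?om0 ?sqr_ge0.
have sumom := quad_weights_sum ps qex.
have DB1 x t : `|D1 q.+1 1%N x t| <= B by exact: B1B.
have DB2 x t : `|D2 q.+1 1%N x t| <= B by exact: B2B.
have DF1 x t : `|D1 q.+2 0%N x t| + `|D1 q.+1 1%N x t| <= 2 * B.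
  by rewrite mulr2n mulrDl mul1r lerD ?B1B.
have DF2 x t : `|D2 q.+2 0%N x t| + `|D2 q.+1 1%N x t| <= 2 * B.
  by rewrite mulr2n mulrDl mul1r lerD ?B2B.
pose G := `|C0| * H * (2 * B * Num.sqrt (xb - xa)).
have G2 : G ^+ 2 = k2 ^+ 2 * H ^+ 2 by rewrite /G /k2; ring.
have eps2 : eps ^+ 2 = k1 ^+ 2 * H ^+ 2 by rewrite /eps /k1; ring.
have epsf2 : ((radau_cst q false + 1) * (B * H)) ^+ 2 <= eps ^+ 2.
  by rewrite lerXn2r ?nnegrE // !mulr_ge0 // addr_ge0.
have epst2 : ((radau_cst q true + 1) * (B * H)) ^+ 2 <= eps ^+ 2.
  by rewrite lerXn2r ?nnegrE // !mulr_ge0 // addr_ge0.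
have dE t : 0 < t < T -> exists2 dE, is_derive t 1 (fun t => n1 t + n2 t) dE &
    dE <= A * (n1 t + n2 t) + Bc * H ^+ 2.
  move=> tT.
  have [d1 d1E est1] := field_estimate (Z := fun j k => C1 * (`|e1 j k t| + `|e2 j k t| + 2 * eps))
    ab ps sD1 br1 dr1 per1' sch1 qin qex tT
    DB1 DF1 qcons om0 (fun j k => fZ1 t j k tT).
  have [d2 d2E est2] := field_estimate (Z := fun j k => C1 * (`|e2 j k t| + `|e1 j k t| + 2 * eps))
    ab ps sD2 br2 dr2 per2' sch2 qin qex tT
    DB2 DF2 qcons om0 (fun j k => fZ2 t j k tT).
  exists (2 * (\sum_(j < size s) \sum_(k < K j) om j k * (d1 j k * e1 j k t))
          + 2 * (\sum_(j < size s) \sum_(k < K j) om j k * (d2 j k * e2 j k t))).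
    by apply: is_deriveD; exact: is_derive_weighted_sqr.
  have W1 : \sum_(j < size s) \sum_(k < K j)
      om j k * (C1 * (`|e1 j k t| + `|e2 j k t| + 2 * eps) * `|e1 j k t|)
      <= C1 * (4 * (n1 t + n2 t) + eps ^+ 2 * (xb - xa)).
    exact: (weighted_sum_le (e := fun j k => e1 j k t) (f := fun j k => e2 j k t)
      (Z := fun j k => C1 * (`|e1 j k t| + `|e2 j k t| + 2 * eps))).
  have W2 : \sum_(j < size s) \sum_(k < K j)
      om j k * (C1 * (`|e2 j k t| + `|e1 j k t| + 2 * eps) * `|e2 j k t|)
      <= C1 * (4 * (n2 t + n1 t) + eps ^+ 2 * (xb - xa)).
    exact: (weighted_sum_le (e := fun j k => e2 j k t) (f := fun j k => e1 j k t)
      (Z := fun j k => C1 * (`|e2 j k t| + `|e1 j k t| + 2 * eps))).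
  have q1 := ler_wpM2r L0 epsf2; have q2 := ler_wpM2r L0 epst2.
  have -> : A * (n1 t + n2 t) + Bc * H ^+ 2 =
      2 * (n1 t + n2 t) + 4 * C1 * (4 * (n1 t + n2 t))
      + (2 + 4 * C1) * (eps ^+ 2 * (xb - xa)) + 2 * G ^+ 2.
    by rewrite /A /Bc G2 eps2; ring.
  have est1' : \sum_(j < size s) \sum_(k < K j) om j k * (d1 j k * e1 j k t) <=
    ((radau_cst q false + 1) * (B * H)) ^+ 2 * (xb - xa) / 2 + n1 t / 2
    + (G ^+ 2 / 2 + n1 t / 2)
    + \sum_(j < size s) \sum_(k < K j)
      om j k * (C1 * (`|e1 j k t| + `|e2 j k t| + 2 * eps) * `|e1 j k t|) := est1.
  have est2' : \sum_(j < size s) \sum_(k < K j) om j k * (d2 j k * e2 j k t) <=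
    ((radau_cst q true + 1) * (B * H)) ^+ 2 * (xb - xa) / 2 + n2 t / 2
    + (G ^+ 2 / 2 + n2 t / 2)
    + \sum_(j < size s) \sum_(k < K j)
      om j k * (C1 * (`|e2 j k t| + `|e1 j k t| + 2 * eps) * `|e2 j k t|) := est2.
  have est1'' := le_trans est1' (lerD (lexx _) W1).
  have est2'' := le_trans est2' (lerD (lexx _) W2).
  move: est1'' est2'' q1 q2; clear.
  move: (\sum_(j < _) _) (\sum_(j < _) _) (_ ^+ 2 * (xb - xa)) (_ ^+ 2 * (xb - xa)).
  move: (n1 t) (n2 t) (G ^+ 2) (eps ^+ 2 * (xb - xa)) => m1 m2 g z S1 S2 y1 y2.
  lra.
have cE : {within `[0, T], continuous (fun t => n1 t + n2 t)}.
  have c1 : {within `[0, T], continuous n1}.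
    apply: continuous_weighted_sqr => j k js kK.
    have cw : {within `[0, T], continuous (w1h (xq j k))}.
      by have [] := ct j (xq j k) js; rewrite ?inE //; apply/cellE; exact: qin.
    exact: (continuous_disc_err ps sD1 js cw).
  have c2' : {within `[0, T], continuous n2}.
    apply: continuous_weighted_sqr => j k js kK.
    have cw : {within `[0, T], continuous (w2h (xq j k))}.
      by have [] := ct j (xq j k) js; rewrite ?inE //; apply/cellE; exact: qin.
    exact: (continuous_disc_err ps sD2 js cw).
  by move=> t; apply: cvgD; [exact: c1|exact: c2'].
have T00 : 0 <= (0 : R) <= T by rewrite lexx.
have E0 : n1 0 + n2 0 = 0.
  have [_ orth1 end1] := rad1; have [_ orth2 end2] := rad2.
  have ini1 x : xa <= x <= xb -> D1 0%N 0%N x 0 = w1 x 0 by move=> xab; exact: D1E.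
  have ini2 x : xa <= x <= xb -> D2 0%N 0%N x 0 = w2 x 0 by move=> xab; exact: D2E.
  have z1 j k : (j < size s)%N -> (k < K j)%N -> e1 j k 0 = 0.
    move=> js kK; exact: (disc_err_initial (e := false) ps sD1 br1 qin js kK T0' ini1 orth1 end1).
  have z2 j k : (j < size s)%N -> (k < K j)%N -> e2 j k 0 = 0.
    move=> js kK; exact: (disc_err_initial (e := true) ps sD2 br2 qin js kK T0' ini2 orth2 end2).
  rewrite /n1 /n2 !big1 ?addr0 // => j _; apply: big1 => k _.
    by rewrite z2 // expr0n mulr0.
  by rewrite z1 // expr0n mulr0.
have ET := gronwall A0 (mulr_ge0 Bc0 (sqr_ge0 H)) T0' cE dE E0.
have TT : 0 <= T <= T by rewrite T0' lexx.
have DB1' x t : `|D1 q.+1 0%N x t| <= B by exact: B1B.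
have DB2' x t : `|D2 q.+1 0%N x t| <= B by exact: B2B.
have L2w1 : (L2norm xa xb (fun x => (w1 x T - w1h x T)%R)
    <= (Num.sqrt (2 * n1 T + 2 * ((radau_cst q false + 1) * (B * H)) ^+ 2 * (xb - xa)))%:E)%E.
  by apply: (L2norm_error_le false ps sD1 br1 qin qex TT _ DB1') => x xab; exact: D1E.
have L2w2 : (L2norm xa xb (fun x => (w2 x T - w2h x T)%R)
    <= (Num.sqrt (2 * n2 T + 2 * ((radau_cst q true + 1) * (B * H)) ^+ 2 * (xb - xa)))%:E)%E.
  by apply: (L2norm_error_le true ps sD2 br2 qin qex TT _ DB2') => x xab; exact: D2E.
have sq (m z : R) : m <= n1 T + n2 T -> z <= eps ^+ 2 ->
    Num.sqrt (2 * m + 2 * z * (xb - xa)) <= Num.sqrt c2 * H.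
  move=> mE zE; rewrite -[H]ger0_norm // -sqrtr_sqr -sqrtrM; last first.
    by rewrite /c2 addr_ge0 // mulr_ge0 // !mulr_ge0 // expR_ge0.
  apply: ler_wsqrtr.
  have -> : c2 * H ^+ 2 = 2 * (expR (A * T) * (Bc * H ^+ 2 * T)) + 2 * (eps ^+ 2 * (xb - xa)).
    by rewrite /c2 eps2; ring.
  apply: lerD; first by rewrite ler_wpM2l // (le_trans mE).
  by rewrite -mulrA ler_wpM2l // ler_wpM2r.
apply: (le_trans (leeD L2w1 L2w2)); rewrite -EFinD lee_fin.
have m1 : n1 T <= n1 T + n2 T by rewrite lerDl.
have m2 : n2 T <= n1 T + n2 T by rewrite lerDr.
apply: (le_trans (lerD (sq _ _ m1 epsf2) (sq _ _ m2 epst2))).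
rewrite mulrDl mul1r; lra.
Qed.
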